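(* Let $\mathbb{F}$ be a field and let $V=\mathbb{F}^2\otimes\mathbb{F}^2\otimes\mathbb{F}^3$. Let $G$ be the setwise stabiliser in $\mathrm{GL}(V)$ of the set of fundamental (rank one) tensors of $V$, and let $H$ be the subgroup of $G$ induced by $\mathrm{GL}(\mathbb{F}^2)\times\mathrm{GL}(\mathbb{F}^2)\times\mathrm{GL}(\mathbb{F}^3)$. (1) If $\mathbb{F}$ is a finite field or $\mathbb{F}=\mathbb{R}$, then there are precisely $10$ $H$-orbits and precisely $9$ $G$-orbits of tensors in $V$. (2) If $\mathbb{F}$ is an algebraically closed field, then there are precisely $9$ $H$-orbits and precisely $8$ $G$-orbits of tensors in $V$.
   Context: All tensor products are over $\mathbb{F}$. The fundamental tensors (rank one tensors) of $V=V_1\otimes V_2\otimes V_3$ are the tensors $v_1\otimes v_2\otimes v_3$ with each $v_i\in V_i\setminus\{0\}$. The group $\mathrm{GL}(V_1)\times\mathrm{GL}(V_2)\times\mathrm{GL}(V_3)$ acts linearly on $V$ by $(g_1,g_2,g_3): v_1\otimes v_2\otimes v_3\mapsto v_1^{g_1}\otimes v_2^{g_2}\otimes v_3^{g_3}$, and $H$ denotes the resulting subgroup of $\mathrm{GL}(V)$. The orbits counted are the orbits on all elements of $V$; the orbit $\{0\}$ of the zero tensor is included in the count. *)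

(* Defs.v *)
From mathcomp Require Import all_boot all_order all_algebra.
From mathcomp Require Import mxtens.
From mathcomp Require Import boolp classical_sets functions cardinality reals.

Set Implicit Arguments.
Unset Strict Implicit.
Unset Printing Implicit Defensive.

Import GRing.Theory.
Local Open Scope ring_scope.
Local Open Scope classical_set_scope.

(* F^a (x) F^b (x) F^c is modelled by row vectors of length a * b * c, the pure
   tensors being the Kronecker products of row vectors.  GL(V) consists of the
   invertible matrices, acting on the right, t^g = t *m g. *)
Notation tensor_space F := ('rV[F]_(2 * 2 * 3)).

Section Tensors.
Variable F : fieldType.
Local Notation V := (tensor_space F).
Local Notation endV := ('M[F]_(2 * 2 * 3)).

(* The row count 1 * 1 * 1 of the Kronecker product is convertible to 1. *)
Definition pure_tensor (v1 v2 : 'rV[F]_2) (v3 : 'rV[F]_3) : V :=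
  v1 *t v2 *t v3.

Lemma pure_tensorE v1 v2 v3 i j k :
  pure_tensor v1 v2 v3 0 (mxtens_index (mxtens_index (i, j), k)) =
  v1 0 i * v2 0 j * v3 0 k.
Proof. by rewrite /pure_tensor !mxE !mxtens_indexK /= !(ord1 (_ : 'I_1)). Qed.

Definition fundamental_tensors : set V :=
  [set t | exists v1 v2 v3,
     [/\ v1 != 0, v2 != 0, v3 != 0 & t = pure_tensor v1 v2 v3]].

Definition groupG : set endV :=
  [set g | g \in unitmx /\
     [set t *m g | t in fundamental_tensors] = fundamental_tensors].

Definition groupH : set endV :=
  [set g | g \in unitmx /\
     exists (g1 g2 : 'M[F]_2) (g3 : 'M[F]_3),
       [/\ g1 \in unitmx, g2 \in unitmx, g3 \in unitmx &
           forall v1 v2 v3, pure_tensor v1 v2 v3 *m g =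
                            pure_tensor (v1 *m g1) (v2 *m g2) (v3 *m g3)]].

Definition orbit_of (A : set endV) (t : V) : set V := [set t *m g | g in A].

Definition orbits (A : set endV) : set (set V) := range (orbit_of A).

Lemma groupH_tens (g1 g2 : 'M[F]_2) (g3 : 'M[F]_3) :
  g1 \in unitmx -> g2 \in unitmx -> g3 \in unitmx ->
  groupH (g1 *t g2 *t g3).
Proof.
move=> u1 u2 u3; split; first by rewrite !tensmx_unit.
exists g1, g2, g3; split=> // v1 v2 v3.
rewrite /pure_tensor -[v1 *m g1 *t _]tensmx_mul.
exact (tensmx_mul (v1 *t v2) v3 (g1 *t g2) g3).
Qed.

Lemma groupH_subG : groupH `<=` groupG.
Proof.
have nz n (v : 'rV[F]_n) (h : 'M[F]_n) : h \in unitmx -> v != 0 -> v *m h != 0.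
  move=> uh; apply: contra_neq => vh0.
  by rewrite -[v](mulmxK uh) vh0 mul0mx.
move=> g [ug [g1 [g2 [g3 [u1 u2 u3 gE]]]]]; split=> //.
apply/seteqP; split=> [_ [t [v1 [v2 [v3 [n1 n2 n3 ->]]]] <-]|].
  exists (v1 *m g1), (v2 *m g2), (v3 *m g3).
  by split; [exact: nz|exact: nz|exact: nz|exact: gE].
move=> _ [v1 [v2 [v3 [n1 n2 n3 ->]]]].
exists (pure_tensor (v1 *m invmx g1) (v2 *m invmx g2) (v3 *m invmx g3)).
  exists (v1 *m invmx g1), (v2 *m invmx g2), (v3 *m invmx g3).
  by split=> //; apply: nz; rewrite ?unitmx_inv.
by rewrite gE !mulmxKV.
Qed.

End Tensors.

Arguments groupG F : clear implicits.
Arguments groupH F : clear implicits.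

(* Main.v *)
Require Import Defs.
From HB Require Import structures.
From mathcomp Require Import all_boot all_order all_algebra.
From mathcomp Require Import mxtens ring zify.
From mathcomp Require Import boolp classical_sets functions cardinality reals.

(** A tensor is a 3 x 4 matrix whose rows are 2 x 2 matrices, and GL_3 acts by
row operations, so an H-orbit is a class of subspaces W of 2 x 2 matrices of
dimension at most 3 under W |-> P W Q.  If dim W = 3, W is the orthogonal of a
nonzero matrix C for the trace form, and the rank of C decides; if dim W = 2
and W contains a singular nonzero matrix, W contains E11 up to equivalence and
the rest is elimination; otherwise W = A <1, B> where the characteristic
polynomial of B has no root.  The last case is void over a closed field, and
over a finite or real closed field it is one orbit, because any two such
algebras F[B] are isomorphic.

An element g of G maps each 3-space F^3 (x) w, with w singular, to a linear
space of rank one matrices whose members share a row, since no 3-space of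
2 x 2 matrices is entirely singular.  Comparing these spaces along
w = e_i (x) e_j gives g = h (x) A with h preserving singularity.  Hence the
dimension of W and the position of its singular matrices are G-invariants, and
only the orbits of e_1 (x) F^2 and F^2 (x) e_1 are fused, by the swap. *)

Set Implicit Arguments.
Unset Strict Implicit.
Unset Printing Implicit Defensive.

Import Order.TTheory GRing.Theory Num.Theory.
Local Open Scope ring_scope.

(** * Quadratic polynomials without roots *)

Section Quadratics.

(** For a 2 x 2 matrix [B] of trace [s] and determinant [n] the polynomial is [det (x + B)], whence
    the sign of [s]. *)
Definition rootless (F : fieldType) (s n : F) := forall x, x ^+ 2 + s * x + n != 0.

(** The form is the norm of [x + y B]; if [y] were nonzero, [x / y] would be a root. *)
Lemma rootless_norm (F : fieldType) (s n x y : F) : rootless s n ->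
  x ^+ 2 + s * x * y + n * y ^+ 2 = 0 -> x = 0 /\ y = 0.
Proof.
move=> rl e; have [y0|y0] := eqVneq y 0.
  by move: e; rewrite y0 expr0n !mulr0 !addr0 => /eqP; rewrite expf_eq0 => /eqP.
case/negP: (rl (x / y)); apply/eqP; apply: (mulfI (expf_neq0 2 y0)).
by rewrite mulr0 -e; field.
Qed.

(** The elements of [A] are counted by fibres of [f], each contained in some pair [x], [r x]. *)
Lemma leq_card_fibres2 (T U : finType) (f : T -> U) (r : T -> T) (A : {set T}) :
  {in A &, forall x y, f x = f y -> y = x \/ y = r x} -> (#|A| <= 2 * #|f @: A|)%N.
Proof.
move=> fA; rewrite -sum1_card (partition_big_imset f) /= mulnC -sum_nat_const.
apply: leq_sum => _ /imsetP[x xA ->]; rewrite sum1_card.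
apply: (@leq_trans #|[set x; r x]|); last by rewrite cards2; case: (_ != _).
apply: subset_leq_card; apply/fintype.subsetP=> y; rewrite !inE => /andP[yA /eqP fy].
by case: (fA x y xA yA (esym fy)) => ->; rewrite eqxx ?orbT.
Qed.

(** The two equations say [(u1 + u2 B) (v1 + v2 B) = 0] where [B^2 = s B - n]. The norm is
    multiplicative and vanishes only at 0, so [F[B]] has no zero divisors. *)
Lemma norm_form_mul0 (F : fieldType) (s n u1 u2 v1 v2 : F) : rootless s n ->
  u1 * v1 - n * u2 * v2 = 0 -> u1 * v2 + u2 * v1 + s * u2 * v2 = 0 ->
  (u1 = 0 /\ u2 = 0) \/ (v1 = 0 /\ v2 = 0).
Proof.
move=> rl c1 c2; pose N (x y : F) := x ^+ 2 + s * x * y + n * y ^+ 2.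
have : N u1 u2 * N v1 v2 == 0.
  have -> : N u1 u2 * N v1 v2 =
      N (u1 * v1 - n * u2 * v2) (u1 * v2 + u2 * v1 + s * u2 * v2).
    by rewrite /N; ring.
  by rewrite c1 c2 /N !(expr0n, mulr0, addr0).
by rewrite mulf_eq0 => /orP[] /eqP /(rootless_norm rl); [left|right].
Qed.

Section FiniteField.
Variable F : finFieldType.

(** Sending two elements to their sum and product is a symmetric map, hence not injective, hence not
    onto over a finite field. A pair that it misses gives the coefficients of a quadratic that does
    not split. *)
Lemma rootless_exists_finite : exists s n : F, rootless s n.
Proof.
pose g (p : F * F) := (p.1 + p.2, p.1 * p.2).
have [p gp] : exists p, p \notin g @: [set: F * F].
  apply/existsP; apply: contraT; rewrite negb_exists => /forallP gT.
  have /imset_injP inj_g : #|g @: [set: F * F]| == #|[set: F * F]|.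
    apply/eqP; apply: eq_card => p; rewrite [RHS]inE.
    by have := gT p; rewrite negbK.
  have : (0, 1) = (1, 0) :> F * F.
    by apply: inj_g; rewrite ?inE // /g /= addrC mulrC.
  by move=> [/eqP]; rewrite eq_sym oner_eq0.
exists p.1, p.2 => x; apply: contraNneq gp => e; apply/imsetP.
(* The opposites of the two roots have sum [p.1] and product [p.2]. *)
exists (- x, p.1 + x) => //; rewrite /g /= [LHS]surjective_pairing.
congr pair; first by ring.
by apply/eqP; rewrite -subr_eq0 -e; apply/eqP; ring.
Qed.

(* (a, b) |-> (a + b, a b) and (x, y) |-> (trace, norm) of x + y B have fibres
   of size at most 2, and a monic quadratic cannot both split over F and be the
   characteristic polynomial of some x + y B with y != 0.  So they reach at
   least (q^2 - q)/2 + q + (q^2 - q)/2 = q^2 monic quadratics, that is, all. *)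
Lemma rootless_unique_finite (s n s0 n0 : F) : rootless s n -> rootless s0 n0 ->
  exists x y, x *+ 2 + s * y = s0 /\ x ^+ 2 + s * x * y + n * y ^+ 2 = n0.
Proof.
move=> rl rl0.
pose g (p : F * F) := (p.1 + p.2, p.1 * p.2).
pose f (p : F * F) := (p.1 *+ 2 + s * p.2, p.1 ^+ 2 + s * p.1 * p.2 + n * p.2 ^+ 2).
pose diag := [set (c, c) | c : F]; pose axis := [set (c, 0) | c : F] : {set F * F}.
have gE a b c d : g (a, b) = g (c, d) -> c = a \/ c = b.
  move=> [e1 e2]; have /eqP : (c - a) * (c - b) = 0.
    transitivity (c ^+ 2 - c * (a + b) + a * b); first by ring.
    by rewrite e1 e2; ring.
  by rewrite mulf_eq0 !subr_eq0 => /orP[] /eqP; [left|right].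
(* With [z = x + y B], the equations [c1] and [c2] say that [(z - a) (z - b) = 0] in [F[B]], so [z]
   is [a] or [b]. *)
have gfE x y a b : f (x, y) = g (a, b) -> y = 0.
  move=> [e1 e2]; have c1 : (x - a) * (x - b) - n * y * y = 0.
    by transitivity (x ^+ 2 - x * (a + b) + a * b - n * y ^+ 2);
      [ring|rewrite -e1 -e2; ring].
  have c2 : (x - a) * y + y * (x - b) + s * y * y = 0.
    by transitivity (y * (x *+ 2 + s * y - (a + b))); [ring|rewrite e1; ring].
  by case: (norm_form_mul0 rl c1 c2) => -[].
(* Two elements [z], [z'] of [F[B]] with the same trace and norm satisfy
   [(z' - z) (z' - conj z) = 0], where [conj z = (x + s y) - y B]. *)
have fE x y x' y' : f (x, y) = f (x', y') ->
    (x', y') = (x, y) \/ (x', y') = (x + s * y, - y).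
  move=> [e1 e2].
  have c1 : (x' - x) * (x' - (x + s * y)) - n * (y' - y) * (y' + y) = 0.
    transitivity ((x ^+ 2 + s * x * y + n * y ^+ 2)
       - (x' ^+ 2 + s * x' * y' + n * y' ^+ 2)
       + x' * (x' *+ 2 + s * y' - (x *+ 2 + s * y))); first by ring.
    by rewrite e1 e2; ring.
  have c2 : (x' - x) * (y' + y) + (y' - y) * (x' - (x + s * y))
            + s * (y' - y) * (y' + y) = 0.
    by transitivity (y' * (x' *+ 2 + s * y' - (x *+ 2 + s * y))); [ring|rewrite e1; ring].
  case: (norm_form_mul0 rl c1 c2) => -[/eqP + /eqP]; rewrite subr_eq0 ?subr_eq0 ?addr_eq0.
    by move=> /eqP -> /eqP ->; left.
  by move=> /eqP -> /eqP ->; right.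
have cD : #|diag| = #|F| by rewrite card_imset // => c d [].
have cA : #|axis| = #|F| by rewrite card_imset // => c d [].
have cgD : #|g @: diag| = #|F|.
  rewrite -cD; apply: card_in_imset => _ _ /imsetP[c _ ->] /imsetP[d _ ->] /gE.
  by case=> ->.
have cgC : (#|~: diag| <= 2 * #|g @: ~: diag|)%N.
  apply: (@leq_card_fibres2 _ _ g (fun p => (p.2, p.1))) => -[a b] [c d] _ _ gab.
  have [ca|cb] := gE _ _ _ _ gab; [left|right].
    by move: gab; rewrite ca => -[/addrI ->].
  by move: gab; rewrite cb /= => -[]; rewrite addrC => /addrI ->.
have cfC : (#|~: axis| <= 2 * #|f @: ~: axis|)%N.
  apply: (@leq_card_fibres2 _ _ f (fun p => (p.1 + s * p.2, - p.2))) => -[a b] [c d] _ _.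
  exact: fE.
have gC a b : g (a, b) = g (b, a) by rewrite /g addrC mulrC.
have disj1 : [disjoint g @: diag & g @: ~: diag].
  rewrite disjoint_subset; apply/fintype.subsetP=> _ /imsetP[_ /imsetP[c _ ->] ->].
  rewrite !inE.
  apply/imsetP=> -[[a b]]; rewrite inE => /negP ab e.
  apply: ab; apply/imsetP; exists a => //.
  have ac : a = c by case: (gE _ _ _ _ e).
  have bc : b = c by rewrite gC in e; case: (gE _ _ _ _ e).
  by rewrite ac bc.
have disj2 : [disjoint g @: [set: F * F] & f @: ~: axis].
  rewrite disjoint_subset; apply/fintype.subsetP=> _ /imsetP[[a b] _ ->]; rewrite !inE.
  apply/imsetP=> -[[x y]]; rewrite inE => /negP xy e.
  apply: xy; apply/imsetP; exists x => //.
  by rewrite (gfE _ _ _ _ (esym e)).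
have gT : g @: [set: F * F] = g @: diag :|: g @: ~: diag by rewrite -imsetU finset.setUCr.
have card_gf : (#|F| * #|F| <= #|g @: [set: F * F] :|: f @: ~: axis|)%N.
  have -> : #|g @: [set: F * F] :|: f @: ~: axis| =
      (#|g @: [set: F * F]| + #|f @: ~: axis|)%N.
    by apply/eqP; rewrite (leq_card_setU _ _).2.
  have -> : #|g @: [set: F * F]| = (#|g @: diag| + #|g @: ~: diag|)%N.
    by rewrite gT; apply/eqP; rewrite (leq_card_setU _ _).2.
  have := cardsC diag; have := cardsC axis; rewrite cD cA cgD card_prod.
  move: cgC cfC; move: #|g @: _| #|f @: _| #|~: diag| #|~: axis| => k l m p.
  by move: (#|F| * #|F|)%N => q2; lia.
have : (s0, n0) \in (g @: [set: F * F] :|: f @: ~: axis).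
  have /eqP -> : (g @: [set: F * F] :|: f @: ~: axis) == [set: F * F].
    by rewrite eqEcard finset.subsetT cardsT card_prod.
  by rewrite inE.
rewrite inE => /orP[/imsetP[[a b] _ [sE nE]]|/imsetP[[x y] _ [-> ->]]];
  last by exists x, y.
(* A pair in the image of [g] belongs to a quadratic that splits, with root [- a]. *)
by case/negP: (rl0 (- a)); rewrite sE nE; apply/eqP; ring.
Qed.

End FiniteField.

(** Without roots, [d = 4 n - s^2] is positive, and [(2 B - s) / sqrt d] is a square root of -1: it
    has trace 0 and norm 1. *)
Lemma rootless_unique_rcf (R : rcfType) (s n : R) : rootless s n ->
  exists x y, x *+ 2 + s * y = 0 /\ x ^+ 2 + s * x * y + n * y ^+ 2 = 1.
Proof.
move=> rl; pose d := n *+ 4 - s ^+ 2.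
have d0 : 0 < d.
  rewrite ltNge; apply/negP=> dle0; pose r := Num.sqrt (- d).
  have rE : r ^+ 2 = s ^+ 2 - n *+ 4 by rewrite sqr_sqrtr ?oppr_ge0 // /d opprB.
  case/negP: (rl ((r - s) / 2%:R)); apply/eqP.
  transitivity ((r ^+ 2 - (s ^+ 2 - n *+ 4)) / 4%:R); first by field.
  by rewrite rE subrr mul0r.
pose r := Num.sqrt d; have rE : r ^+ 2 = d by rewrite sqr_sqrtr // ltW.
have r0 : r != 0 by rewrite gt_eqF // sqrtr_gt0.
exists (- s / r), (2%:R / r); split; first by field.
transitivity (d / r ^+ 2); last by rewrite rE divff // gt_eqF.
by rewrite /d; field.
Qed.

Lemma rootless_rcf (R : rcfType) : rootless (0 : R) 1.
Proof.
by move=> x; rewrite mul0r addr0 gt_eqF // ltr_wpDl ?sqr_ge0 ?ltr01.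
Qed.

Lemma rootless_closed (F : closedFieldType) (s n : F) : ~ rootless s n.
Proof.
have [x xE] := @solve_monicpoly F 2 (fun i => if i == 0%N then - n else - s) isT.
move/(_ x)/negP; apply; apply/eqP; rewrite xE !big_ord_recl big_ord0 /=.
by rewrite /bump /=; ring.
Qed.

End Quadratics.

Local Open Scope classical_set_scope.

(** * Tensors as 3 x 4 matrices *)

Section Coordinates.
Variable F : fieldType.
Implicit Types (t : 'rV[F]_(2 * 2 * 3)) (T : 'M[F]_(3, 2 * 2)).
Implicit Types (w : 'rV[F]_(2 * 2)) (X P Q : 'M[F]_2).

Definition mat t : 'M[F]_(3, 2 * 2) := \matrix_(k, p) t 0 (mxtens_index (p, k)).

Definition ten T : 'rV[F]_(2 * 2 * 3) :=
  \row_q T (mxtens_unindex q).2 (mxtens_unindex q).1.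

Definition sq w : 'M[F]_2 := \matrix_(i, j) w 0 (mxtens_index (i, j)).

Definition flat X : 'rV[F]_(2 * 2) :=
  \row_p X (mxtens_unindex p).1 (mxtens_unindex p).2.

Lemma matK : cancel mat ten.
Proof.
by move=> t; apply/rowP=> q; case: (mxtens_indexP q) => p k; rewrite !mxE mxtens_indexK.
Qed.

Lemma tenK : cancel ten mat.
Proof. by move=> T; apply/matrixP=> k p; rewrite !mxE mxtens_indexK. Qed.

Lemma sqK : cancel sq flat.
Proof.
by move=> w; apply/rowP=> p; case: (mxtens_indexP p) => i j; rewrite !mxE mxtens_indexK.
Qed.

Lemma flatK : cancel flat sq.
Proof. by move=> X; apply/matrixP=> i j; rewrite !mxE mxtens_indexK. Qed.

Fact mat_is_linear : linear mat.
Proof. by move=> a t s; apply/matrixP=> k p; rewrite !mxE. Qed.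
HB.instance Definition _ := GRing.isLinear.Build F _ _ _ mat mat_is_linear.

Fact ten_is_linear : linear ten.
Proof. by move=> a t s; apply/rowP=> k; rewrite !mxE. Qed.
HB.instance Definition _ := GRing.isLinear.Build F _ _ _ ten ten_is_linear.

Fact sq_is_linear : linear sq.
Proof. by move=> a t s; apply/matrixP=> k p; rewrite !mxE. Qed.
HB.instance Definition _ := GRing.isLinear.Build F _ _ _ sq sq_is_linear.

Fact flat_is_linear : linear flat.
Proof. by move=> a t s; apply/rowP=> k; rewrite !mxE. Qed.
HB.instance Definition _ := GRing.isLinear.Build F _ _ _ flat flat_is_linear.

Lemma sum_mxtens m n (f : 'I_(m * n) -> F) :
  \sum_q f q = \sum_i \sum_j f (mxtens_index (i, j)).
Proof.
rewrite pair_big /= (reindex (@mxtens_index m n)) /=.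
  by apply: eq_bigr => -[i j].
by exists (@mxtens_unindex m n) => q _; rewrite ?mxtens_indexK ?mxtens_unindexK.
Qed.

Lemma mat_tens t (h : 'M_(2 * 2)) (g : 'M_3) :
  mat (t *m (h *t g)) = g^T *m mat t *m h.
Proof.
apply/matrixP=> k p; rewrite !mxE sum_mxtens; apply: eq_bigr => q _.
rewrite !mxE big_distrl /=; apply: eq_bigr => l _.
by rewrite !mxE !mxtens_indexK /=; ring.
Qed.

Lemma sq_tens w P Q : sq (w *m (P *t Q)) = P^T *m sq w *m Q.
Proof.
apply/matrixP=> i j; rewrite !mxE sum_mxtens exchange_big.
apply: eq_bigr => l _ /=; rewrite !mxE big_distrl /=; apply: eq_bigr => k _.
by rewrite !mxE !mxtens_indexK /=; ring.
Qed.

Lemma mat_pure v1 v2 v3 : mat (pure_tensor v1 v2 v3) = v3^T *m flat (v1^T *m v2).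
Proof.
apply/matrixP=> k p; case: (mxtens_indexP p) => i j.
by rewrite mxE pure_tensorE !mxE !big_ord1 !mxE !mxtens_indexK /= big_ord1 !mxE; ring.
Qed.

Lemma sq_eq0 w : (sq w == 0) = (w == 0).
Proof. by rewrite -(inj_eq (can_inj sqK)) linear0. Qed.

Lemma flat_eq0 X : (flat X == 0) = (X == 0).
Proof. by rewrite -(inj_eq (can_inj flatK)) linear0. Qed.

Lemma forall_ord2 (R : 'I_2 -> Prop) : R 0 -> R 1 -> forall i, R i.
Proof.
move=> r0 r1 [[|[|//]] h].
- by rewrite (_ : Ordinal h = 0) //; apply: val_inj.
- by rewrite (_ : Ordinal h = 1) //; apply: val_inj.
Qed.

Lemma forall_ord3 (R : 'I_3 -> Prop) : R 0 -> R 1 -> R 2%:R -> forall i, R i.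
Proof.
move=> r0 r1 r2 [[|[|[|//]]] h].
- by rewrite (_ : Ordinal h = 0) //; apply: val_inj.
- by rewrite (_ : Ordinal h = 1) //; apply: val_inj.
- by rewrite (_ : Ordinal h = 2%:R) //; apply: val_inj.
Qed.

Lemma sum_ord2 (U : nmodType) (f : 'I_2 -> U) : \sum_i f i = f 0 + f 1.
Proof.
by rewrite !big_ord_recl big_ord0 addr0; congr (f _ + f _); apply: val_inj.
Qed.

Lemma sum_ord3 (U : nmodType) (f : 'I_3 -> U) :
  \sum_i f i = f 0 + f 1 + f 2%:R.
Proof.
rewrite !big_ord_recl big_ord0 addr0 addrA.
by congr (f _ + f _ + f _); apply: val_inj.
Qed.

Definition mx2 (a b c d : F) : 'M[F]_2 :=
  \matrix_(i, j) if i == 0 then (if j == 0 then a else b)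
                 else (if j == 0 then c else d).

Lemma mx2E X : X = mx2 (X 0 0) (X 0 1) (X 1 0) (X 1 1).
Proof. by apply/matrixP; do 2!apply: forall_ord2; rewrite !mxE. Qed.

Lemma mx2P X : exists a b c d, X = mx2 a b c d.
Proof. by do 4!eexists; apply: mx2E. Qed.

Lemma det2 X : \det X = X 0 0 * X 1 1 - X 0 1 * X 1 0.
Proof.
rewrite (expand_det_row _ 0) !big_ord_recl big_ord0 /cofactor !det_mx11 !mxE /=.
transitivity (X 0 0 * ((-1) ^+ 0 * X 1 1) + (X 0 1 * ((-1) ^+ 1 * X 1 0) + 0)).
  by congr (_ * (_ * X _ _) + (X _ _ * (_ * X _ _) + _)); exact: val_inj.
by rewrite expr0 expr1; ring.
Qed.

Lemma det_mx2 a b c d : \det (mx2 a b c d) = a * d - b * c.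
Proof. by rewrite det2 !mxE. Qed.

Lemma mul_mx2 a b c d a' b' c' d' :
  mx2 a b c d *m mx2 a' b' c' d' =
  mx2 (a * a' + b * c') (a * b' + b * d') (c * a' + d * c') (c * b' + d * d').
Proof.
by apply/matrixP; do 2!apply: forall_ord2; rewrite !mxE !sum_ord2 !mxE.
Qed.

Lemma add_mx2 a b c d a' b' c' d' :
  mx2 a b c d + mx2 a' b' c' d' = mx2 (a + a') (b + b') (c + c') (d + d').
Proof. by apply/matrixP; do 2!apply: forall_ord2; rewrite !mxE. Qed.

Lemma scale_mx2 k a b c d : k *: mx2 a b c d = mx2 (k * a) (k * b) (k * c) (k * d).
Proof. by apply/matrixP; do 2!apply: forall_ord2; rewrite !mxE. Qed.

Lemma tr_mx2 a b c d : (mx2 a b c d)^T = mx2 a c b d.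
Proof. by apply/matrixP; do 2!apply: forall_ord2; rewrite !mxE. Qed.

Lemma mx2_eq a b c d a' b' c' d' :
  mx2 a b c d = mx2 a' b' c' d' <-> [/\ a = a', b = b', c = c' & d = d'].
Proof.
split=> [e|[-> -> -> ->]//].
by move: (congr1 (fun X : 'M_2 => (X 0 0, X 0 1, X 1 0, X 1 1)) e);
  rewrite !mxE /= => -[].
Qed.

Lemma mx2_0 : 0 = mx2 0 0 0 0.
Proof. by apply/matrixP; do 2!apply: forall_ord2; rewrite !mxE. Qed.

Lemma mx2_1 : 1%:M = mx2 1 0 0 1.
Proof. by apply/matrixP; do 2!apply: forall_ord2; rewrite !mxE. Qed.

Definition mx2_calc := (mul_mx2, add_mx2, scale_mx2, tr_mx2, det_mx2).

Lemma rank_factor m n (A : 'M[F]_(m, n)) :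
  exists (B : 'M[F]_(m, \rank A)) (C : 'M[F]_(\rank A, n)), A = B *m C.
Proof. by exists (col_base A), (row_base A); rewrite mulmx_base. Qed.

Lemma rank1_factor m n (A : 'M[F]_(m, n)) : \rank A = 1 ->
  exists (u : 'rV[F]_m) (v : 'rV[F]_n), A = u^T *m v.
Proof.
case: (rank_factor A) => B [C ABC] r1.
by move: B C ABC; rewrite r1 => B C ->; exists B^T, C; rewrite trmxK.
Qed.

Lemma rV_neq0 n (v : 'rV[F]_n) : v != 0 -> exists i, v 0 i != 0.
Proof.
move=> v0; apply/existsP; apply: contraNT v0; rewrite negb_exists => /forallP v0.
by apply/eqP/rowP=> i; rewrite mxE; apply/eqP; move: (v0 i); rewrite negbK.
Qed.

Lemma outer_neq0 m n (u : 'rV[F]_m) (v : 'rV[F]_n) :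
  (u^T *m v != 0) = (u != 0) && (v != 0).
Proof.
apply/idP/andP=> [uv|[/rV_neq0[i ui] /rV_neq0[j vj]]].
  by split; apply: contra_neq uv => ->; rewrite ?trmx0 ?mul0mx ?mulmx0.
apply: contra_neq (mulf_neq0 ui vj) => /matrixP/(_ i j).
by rewrite !mxE big_ord1 !mxE.
Qed.

Lemma rank_singular X : X != 0 -> \det X = 0 -> \rank X = 1.
Proof.
move=> X0 d0; apply/eqP; rewrite eqn_leq lt0n mxrank_eq0 X0 andbT.
rewrite -ltnS ltn_neqAle rank_leq_row andbT -/(row_free X).
by rewrite row_free_unit unitmxE d0 unitr0.
Qed.

Lemma delta_row_neq0 n (i : 'I_n) : 'e_i != 0 :> 'rV[F]_n.
Proof. by apply/eqP=> /rowP/(_ i)/eqP; rewrite !mxE !eqxx oner_eq0. Qed.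

Lemma singular_factor X : X != 0 -> \det X = 0 -> exists (u v : 'rV[F]_2), X = u^T *m v.
Proof. by move=> X0 d0; apply: rank1_factor; apply: rank_singular. Qed.

Lemma det_outer (u v : 'rV[F]_2) : \det (u^T *m v) = 0.
Proof. by rewrite det2 !mxE !big_ord1 !mxE; ring. Qed.

(** Turns the rank one condition into a determinant: a nonzero singular 2 x 2 matrix is an outer
    product. *)
Lemma fundamentalP t : fundamental_tensors t <->
  exists v w, [/\ v != 0, w != 0, \det (sq w) = 0 & mat t = v^T *m w].
Proof.
split=> [[v1 [v2 [v3 [n1 n2 n3 ->]]]]|[v [w [v0 w0 d0 tE]]]].
  exists v3, (flat (v1^T *m v2)); split=> //; last exact: mat_pure.
    by rewrite flat_eq0 outer_neq0 n1.
  by rewrite flatK det_outer.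
have sw0 : sq w != 0 by rewrite sq_eq0.
have [v1 [v2 wE]] := singular_factor sw0 d0.
move: sw0; rewrite wE outer_neq0 => /andP[n1 n2].
exists v1, v2, v; split=> //; apply: (can_inj matK).
by rewrite mat_pure -wE sqK.
Qed.

End Coordinates.

(** * The stabiliser of the fundamental tensors *)

Section Stabiliser.
Variable F : fieldType.
Implicit Types (t : 'rV[F]_(2 * 2 * 3)) (T : 'M[F]_(3, 2 * 2)).
Implicit Types (w : 'rV[F]_(2 * 2)) (X P Q : 'M[F]_2).

Lemma submx_rVC n (u v : 'rV[F]_n) : u != 0 -> (u <= v)%MS -> (v <= u)%MS.
Proof.
move=> u0 /sub_rVP[a uE]; apply/sub_rVP; exists a^-1.
have a0 : a != 0 by apply: contra_neq u0 => a0; rewrite uE a0 scale0r.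
by rewrite uE scalerA mulVf ?scale1r.
Qed.

Lemma row_free_col_mx n (u v : 'rV[F]_n) :
  u != 0 -> ~~ (v <= u)%MS -> row_free (col_mx u v).
Proof.
move=> u0; apply: contraNT => nf.
have su : (u <= u + v)%MS by apply: addsmxSl.
have : (\rank (u + v)%MS <= \rank u)%N.
  rewrite rank_rV u0 addsmxE -ltnS ltn_neqAle rank_leq_row andbT.
  exact: nf.
by rewrite (geq_leqif (mxrank_leqif_sup su)); apply: submx_trans (addsmxSr _ _).
Qed.

(** If both pairs were independent, the left side would be a product of two factors of rank two and
    would have rank two. *)
Lemma rank1_add m n (a1 a2 : 'rV[F]_m) (b1 b2 : 'rV[F]_n)
    (a : 'rV[F]_m) (b : 'rV[F]_n) :
  a1 != 0 -> b1 != 0 -> a1^T *m b1 + a2^T *m b2 = a^T *m b :> 'M[F]_(m, n) ->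
  (a2 <= a1)%MS \/ (b2 <= b1)%MS.
Proof.
move=> na nb e; case: (boolP (a2 <= a1)%MS) => [|fa]; first by left.
case: (boolP (b2 <= b1)%MS) => [|fb]; first by right.
have := row_free_col_mx nb fb; have := row_free_col_mx na fa.
move=> /eqP ra rb; have := mxrankMfree (col_mx a1 a2)^T rb.
rewrite tr_col_mx mul_row_col e -tr_col_mx mxrank_tr ra => r2.
by have := mxrankM_maxl a^T b; rewrite r2 leqNgt ltnS rank_leq_col.
Qed.

Lemma outer_uniq m n (a a' : 'rV[F]_m) (b b' : 'rV[F]_n) :
  a != 0 -> a^T *m b = a'^T *m b' -> exists c, b = c *: b'.
Proof.
move=> /rV_neq0[i ai] /matrixP e; exists (a' 0 i / a 0 i).
apply/rowP=> j; move: (e i j); rewrite !mxE !big_ord1 !mxE => e'.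
by apply: (mulfI ai); rewrite e'; field.
Qed.

Lemma det_scale2 c X : \det X = 0 -> \det (c *: X) = 0.
Proof. by move=> d0; rewrite detZ d0 mulr0. Qed.

(** The cofactor matrix, not transposed, so that the entrywise product of [X] with [cof2 Y] sums to
    the polar form of [det]. *)
Definition cof2 X : 'M[F]_2 := mx2 (X 1 1) (- X 1 0) (- X 0 1) (X 0 0).

Fact cof2_is_linear : linear cof2.
Proof.
by move=> c X Y; rewrite /cof2 scale_mx2 add_mx2 !mxE; apply/mx2_eq; split; ring.
Qed.
HB.instance Definition _ := GRing.isLinear.Build F _ _ _ cof2 cof2_is_linear.

Lemma dot_flat w X :
  (w *m (flat X)^T) 0 0 = \sum_i \sum_j sq w i j * X i j.
Proof.
rewrite mxE sum_mxtens; do 2!apply: eq_bigr => ? _.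
by rewrite !mxE mxtens_indexK.
Qed.

Lemma det_add_polar w w' :
  \det (sq (w + w')) =
  \det (sq w) + \det (sq w') + (w *m (flat (cof2 (sq w')))^T) 0 0.
Proof.
rewrite dot_flat linearD /= !det2 !sum_ord2.
rewrite ![(_ + _ : 'M_2) _ _]mxE ![cof2 _ _ _]mxE /=.
by ring.
Qed.

(* The row space of D would be totally isotropic for the polar form of det,
   which is nondegenerate on a space of dimension 4 < 2 * 3. *)
Lemma no_singular_hyperplane (D : 'M[F]_(3, 2 * 2)) :
  row_free D -> ~ (forall v, \det (sq (v *m D)) = 0).
Proof.
move=> fD sD.
(* [J] represents the polar form; it is invertible because it permutes the coordinates up to
   sign. *)
pose J := lin1_mx (@flat F \o cof2 \o @sq F).
have JE w : w *m J = flat (cof2 (sq w)) by rewrite mul_rV_lin1.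
have fJ : row_free J.
  apply: inj_row_free => w; rewrite JE => /eqP; rewrite flat_eq0 => /eqP c0.
  apply/eqP; rewrite -sq_eq0 [sq w]mx2E; move: c0.
  rewrite /cof2 mx2_0 => /mx2_eq[-> /eqP + /eqP + ->].
  by rewrite !oppr_eq0 => /eqP -> /eqP ->; rewrite -mx2_0.
have : D *m (D *m J)^T = 0.
  apply/matrixP=> k l; rewrite [RHS]mxE.
  have := sD ('e_k + 'e_l); rewrite mulmxDl det_add_polar !sD !add0r -JE.
  rewrite -!rowE -row_mul => <-; rewrite !mxE; apply: eq_bigr => i _.
  by rewrite !mxE; congr (_ * _); apply: eq_bigr => j _; rewrite [row _ _ _ _]mxE.
move/mulmx0_rank_max; rewrite mxrank_tr (mxrankMfree _ fJ).
by rewrite (eqP fD).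
Qed.

(** Two rank one matrices whose sum has rank one have proportional rows or proportional columns. So
    the values of [L] all share their row or all share their column, and the second option would
    yield a 3-space of singular 2 x 2 matrices. *)
Lemma rank1_space (L : {linear 'rV[F]_3 -> 'M[F]_(3, 2 * 2)}) :
  (forall v, v != 0 -> exists a b,
     [/\ a != 0, b != 0, \det (sq b) = 0 & L v = a^T *m b]) ->
  exists B w, B \in unitmx /\ forall v, L v = (v *m B)^T *m w.
Proof.
move=> HL.
have /choice[a /choice[b H]] := fun k => HL _ (@delta_row_neq0 F _ k).
have LE v : L v = \sum_k v 0 k *: ((a k)^T *m b k).
  rewrite {1}[v]row_sum_delta linear_sum; apply: eq_bigr => k _.
  by rewrite linearZ /=; have [_ _ _ ->] := H k.
have Linj v : L v = 0 -> v = 0.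
  move=> Lv; apply: contrapT => /eqP /HL[a' [b' [na nb _ ab]]].
  by have := outer_neq0 a' b'; rewrite -ab Lv eqxx na nb.
case: (pselect (forall k, (b k <= b 0)%MS)) => [Pb|].
  have /choice[c bE] := fun k => sub_rVP (Pb k).
  pose B := \matrix_k (c k *: a k); exists B, (b 0).
  have BE v : L v = (v *m B)^T *m b 0.
    rewrite LE mulmx_sum_row linear_sum mulmx_suml; apply: eq_bigr => k _.
    by rewrite rowK !linearZ /= -scalemxAl {1}bE -scalemxAr -scalemxAl.
  split=> //; rewrite -row_free_unit; apply: inj_row_free => v vB.
  by apply: Linj; rewrite BE vB trmx0 mul0mx.
move=> /existsNP[k1 /negP nb1].
have ab k l : ~~ (b l <= b k)%MS -> (a l <= a k)%MS.
  move=> nbkl; have kl : k != l by apply: contraNneq nbkl => ->.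
  have [na nb _ _] := H k.
  have kl0 : 'e_k + 'e_l != 0 :> 'rV[F]_3.
    apply/eqP=> /matrixP/(_ 0 k)/eqP; rewrite !mxE !eqxx (negbTE kl) addr0 oner_eq0 //.
  have [a' [b' [_ _ _]]] := HL _ kl0; rewrite linearD /=.
  have [_ _ _ ->] := H k; have [_ _ _ ->] := H l.
  by move/(rank1_add na nb) => [|] // h; rewrite h in nbkl.
(* If row [k] is proportional to row 0, the comparison goes through [k1]: its row is a multiple of
   neither, so its column is proportional to both columns. *)
have Pa k : (a k <= a 0)%MS.
  case: (boolP (b k <= b 0)%MS) => [bk|]; last exact: ab.
  have /ab a1k : ~~ (b k1 <= b k)%MS by apply: contra nb1 => /submx_trans; apply.
  have [a10 _ _ _] := H k1.
  exact: submx_trans (submx_rVC a10 a1k) (ab _ _ nb1).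
have /choice[c aE] := fun k => sub_rVP (Pa k).
pose D := \matrix_k (c k *: b k).
have DE v : L v = (a 0)^T *m (v *m D).
  rewrite LE mulmx_sum_row mulmx_sumr; apply: eq_bigr => k _.
  by rewrite rowK -!scalemxAr {1}aE linearZ -scalemxAl.
have [] := @no_singular_hyperplane D.
  by apply: inj_row_free => v vD; apply: Linj; rewrite DE vD mulmx0.
move=> v; have [->|v0] := eqVneq v 0; first by rewrite mul0mx linear0 det0.
have [a' [b' [_ _ d0 e]]] := HL _ v0; rewrite DE in e.
have [a00 _ _ _] := H 0; have [c' ->] := outer_uniq a00 e.
by rewrite linearZ det_scale2.
Qed.

End Stabiliser.

(** * Splitting an element of G into a factor on [F^3] and a factor on 2 x 2 matrices *)

Section Factorization.
Variables (F : fieldType) (g : 'M[F]_(2 * 2 * 3)).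
Hypothesis Gg : groupG F g.
Implicit Types (t : 'rV[F]_(2 * 2 * 3)) (T : 'M[F]_(3, 2 * 2)).
Implicit Types (v : 'rV[F]_3) (w : 'rV[F]_(2 * 2)) (X P Q : 'M[F]_2).

Let gfun T := mat (ten T *m g).

Fact gfun_is_linear : linear gfun.
Proof. by move=> c T S; rewrite /gfun linearP mulmxDl -scalemxAl linearP. Qed.
HB.instance Definition _ := GRing.isLinear.Build F _ _ _ gfun gfun_is_linear.

Let gfun_inj T : gfun T = 0 -> T = 0.
Proof.
have [gU _] := Gg; move=> T0; apply: (can_inj (@tenK F)).
have {}T0 : ten T *m g = 0 by apply: (can_inj (@matK F)); rewrite linear0.
by rewrite linear0 -(mulmxK gU (ten T)) T0 mul0mx.
Qed.

Definition singular_row w := \det (sq w) = 0.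

Let gfun_fund v w : v != 0 -> w != 0 -> singular_row w ->
  exists a b, [/\ a != 0, b != 0, singular_row b & gfun (v^T *m w) = a^T *m b].
Proof.
move=> v0 w0 sw; have [_ Gf] := Gg.
have /fundamentalP[a [b [? ? ? ?]]] : fundamental_tensors (ten (v^T *m w) *m g).
  rewrite -Gf; exists (ten (v^T *m w)) => //; apply/fundamentalP.
  by exists v, w; rewrite tenK.
by exists a, b.
Qed.

Definition gslice w v := gfun (v^T *m w).

Fact gslice_is_linear w : linear (gslice w).
Proof.
by move=> c u v; rewrite /gslice linearP mulmxDl -scalemxAl linearP.
Qed.
HB.instance Definition _ w :=
  GRing.isLinear.Build F _ _ _ (gslice w) (gslice_is_linear w).

Let gslice_rank1 w : w != 0 -> singular_row w ->
  exists B w', B \in unitmx /\ forall v, gfun (v^T *m w) = (v *m B)^T *m w'.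
Proof.
by move=> w0 sw; apply: (@rank1_space _ (gslice w)) => v v0; apply: gfun_fund.
Qed.

(** The slice at [w1 + w2] also has the form [(v C)^T b], hence
    [(v B1)^T b1 + (v B2)^T b2 = (v C)^T b] for all [v]. As [b1] and [b2] are independent, pairing
    with dual vectors shows that [B1] and [B2] are both multiples of [C]. *)
Let parallel_slices w1 w2 B1 B2 b1 b2 :
  w1 != 0 -> ~~ (w2 <= w1)%MS -> singular_row (w1 + w2) ->
  B1 \in unitmx -> B2 \in unitmx ->
  (forall v, gfun (v^T *m w1) = (v *m B1)^T *m b1) ->
  (forall v, gfun (v^T *m w2) = (v *m B2)^T *m b2) ->
  exists c, B2 = c *: B1.
Proof.
move=> w10 nw12 s12 U1 U2 E1 E2.
pose e0 : 'rV[F]_3 := 'e_0; have e00 : e0 != 0 := @delta_row_neq0 F _ 0.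
have b10 : b1 != 0.
  apply: contra_neq e00 => b10; have := E1 e0; rewrite b10 mulmx0 => /gfun_inj /eqP.
  by apply: contraTeq => en0; rewrite outer_neq0 en0.
have nb12 : ~~ (b2 <= b1)%MS.
  (* If [b2 = c b1], a combination of a tensor over [w1] and one over [w2] is killed by [g];
     injectivity then makes [w2] a multiple of [w1]. *)
  apply/negP=> /sub_rVP[c b2E].
  have := E1 (- c *: (e0 *m B2 *m invmx B1)).
  rewrite -scalemxAl mulmxKV // => E.
  have /gfun_inj/eqP : gfun ((- c *: (e0 *m B2 *m invmx B1))^T *m w1 + e0^T *m w2) = 0.
    rewrite linearD /= E E2 b2E -scalemxAr linearZ /= -scalemxAl scaleNr addNr //.
  rewrite addrC addr_eq0 => /eqP e2.
  have [c' w2E] : exists c', w2 = c' *: w1.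
    apply: (@outer_uniq _ _ _ e0 (- (- c *: (e0 *m B2 *m invmx B1)))) => //.
    by rewrite linearN mulNmx.
  by move: nw12; rewrite w2E scalemx_sub.
have [C [b [UC EC]]] : exists B w', B \in unitmx /\
    forall v, gfun (v^T *m (w1 + w2)) = (v *m B)^T *m w'.
  apply: gslice_rank1 => //; apply: contraNneq nw12 => /eqP.
  by rewrite addrC addr_eq0 => /eqP ->; rewrite -scaleN1r scalemx_sub.
(* The two columns of a right inverse are vectors dual to [b1] and [b2]. *)
have /row_freeP[D DE] := row_free_col_mx b10 nb12.
have [x1 x2] : (exists x, b1 *m x = 1%:M /\ b2 *m x = 0) /\
               (exists x, b1 *m x = 0 /\ b2 *m x = 1%:M).
  move: DE; rewrite -[D]hsubmxK mul_col_row (scalar_mx_block 1 1).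
  move=> /eq_block_mx[? ? ? ?].
  by split; [exists (lsubmx D)|exists (rsubmx D)].
have CE v : (v *m B1)^T *m b1 + (v *m B2)^T *m b2 = (v *m C)^T *m b.
  by rewrite -E1 -E2 -EC mulmxDr linearD.
have key (x : 'cV_(2 * 2)) y z : b1 *m x = y%:M -> b2 *m x = z%:M ->
    y *: B1 + z *: B2 = (b *m x) 0 0 *: C.
  move=> y1 z1; apply/row_matrixP=> k; rewrite !rowE.
  have := congr1 (fun A => (A *m x)^T) (CE 'e_k).
  have bx : b *m x = ((b *m x) 0 0)%:M by apply: mx11_scalar.
  move: bx; set c := (b *m x) 0 0 => bx.
  rewrite mulmxDl -!mulmxA y1 z1 bx linearD /=.
  rewrite !trmx_mul !trmxK !tr_scalar_mx !mul_scalar_mx.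
  by rewrite !scalemxAr -mulmxDr => ->.
have [x [/key k1 x12]] := x1; move: (k1 0).
rewrite x12 (raddf0 (@scalar_mx F 1)) => /(_ erefl).
rewrite scale1r scale0r addr0 => B1E.
have [y [y11 y12]] := x2; have := key y 0 1.
rewrite y11 y12 (raddf0 (@scalar_mx F 1)) => /(_ erefl erefl).
rewrite scale1r scale0r add0r => ->.
set c1 := (_ *m x) 0 0 in B1E; exists ((b *m y) 0 0 / c1).
rewrite B1E scalerA divfK //; apply/eqP => c10.
by move: U1; rewrite B1E c10 scale0r unitmxE det0 unitr0.
Qed.

(** Two matrix units in a common row or column have a singular sum, so their slices have
    proportional factors [B]. Any two positions are linked in two such moves, so one matrix [A]
    serves all slices and the scalars go into [h]. *)
Lemma stabiliser_factor : exists A h,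
  [/\ A \in unitmx, h \in unitmx,
      forall t, mat (t *m g) = A *m mat t *m h &
      forall w, singular_row (w *m h) <-> singular_row w].
Proof.
pose e (p : 'I_(2 * 2)) : 'rV[F]_(2 * 2) := 'e_p.
have e0 p : e p != 0 := @delta_row_neq0 F _ p.
have sqe i j k l : sq (e (mxtens_index (i, j))) k l = ((k == i) && (l == j))%:R.
  by rewrite !mxE eqxx /= (inj_eq (can_inj (@mxtens_indexK _ _))).
have se p : singular_row (e p).
  case: (mxtens_indexP p) => i j; rewrite /singular_row det2 !sqe.
  by move: i j; do 2!apply: forall_ord2; rewrite /= ?mulr0 ?mul0r subrr.
have /choice[B /choice[b HB]] := fun p => gslice_rank1 (e0 p) (se p).
have par p q : singular_row (e p + e q) -> exists c, B q = c *: B p.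
  have [->|pq spq] := eqVneq p q; first by exists 1; rewrite scale1r.
  have [Up Ep] := HB p; have [Uq Eq] := HB q.
  apply: (parallel_slices (e0 p) _ spq Up Uq Ep Eq).
  apply/sub_rVP=> -[c /matrixP/(_ 0 q)/eqP]; rewrite !mxE !eqxx.
  by rewrite [q == p]eq_sym (negbTE pq) mulr0 oner_eq0.
pose p0 : 'I_(2 * 2) := mxtens_index (0, 0).
have /choice[c Bc] p : exists c, B p = c *: B p0.
  case: (mxtens_indexP p) => i j.
  (* The path runs from (0, 0) along the row to (0, j), then along the column to (i, j). *)
  have [c1 E1] : exists c, B (mxtens_index (0, j)) = c *: B p0.
    apply: par; rewrite /singular_row det2 linearD /=.
    rewrite ![(_ + _ : 'M_2) _ _]mxE !sqe.
    by move: i j; do 2!apply: forall_ord2; rewrite /= ?mulr0 ?mul0r; ring.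
  have [c2 ->] : exists c, B (mxtens_index (i, j)) = c *: B (mxtens_index (0, j)).
    apply: par; rewrite /singular_row det2 linearD /=.
    rewrite ![(_ + _ : 'M_2) _ _]mxE !sqe.
    by move: i j {E1}; do 2!apply: forall_ord2; rewrite /= ?mulr0 ?mul0r; ring.
  by exists (c2 * c1); rewrite E1 scalerA.
have [U0 _] := HB p0.
pose h := \matrix_p (c p *: b p); pose A := (B p0)^T.
have UA : A \in unitmx by rewrite unitmx_tr.
have hE v w : gfun (v^T *m w) = A *m (v^T *m w) *m h.
  rewrite {1}[w]row_sum_delta mulmx_sumr linear_sum /= -!mulmxA mulmx_sum_row !mulmx_sumr.
  apply: eq_bigr => p _; have [_ Ep] := HB p.
  rewrite -scalemxAr linearZ /= Ep Bc rowK trmx_mul linearZ /=.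
  by rewrite -!scalemxAl -!scalemxAr -!mulmxA scalerA.
have TE T : gfun T = A *m T *m h.
  have -> : T = \sum_k ('e_k)^T *m row k T.
    apply/matrixP=> k p; rewrite summxE (bigD1 k) //= big1 ?addr0 => [|l lk].
      by rewrite !mxE big_ord1 !mxE !eqxx mul1r.
    by rewrite !mxE big_ord1 !mxE /= eq_sym (negbTE lk) mul0r.
  rewrite linear_sum /= mulmx_sumr mulmx_suml; apply: eq_bigr => k _.
  by rewrite hE.
pose v : 'rV[F]_3 := 'e_0; have v0 : v != 0 := @delta_row_neq0 F _ 0.
have Uh : h \in unitmx.
  rewrite -row_free_unit; apply: inj_row_free => w wh.
  have /gfun_inj/eqP : gfun (v^T *m w) = 0 by rewrite TE -!mulmxA wh !mulmx0.
  by apply: contraTeq => w0; rewrite outer_neq0 v0.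
have vA : v *m A^T != 0.
  by apply: contra_neq v0 => vA; rewrite -[v](@mulmxK _ _ _ A^T) ?unitmx_tr // vA mul0mx.
have vhE w : gfun (v^T *m w) = (v *m A^T)^T *m (w *m h).
  by rewrite TE trmx_mul trmxK !mulmxA.
exists A, h; split=> // [t|w]; first by rewrite -TE /gfun matK.
have [->|w0] := eqVneq w 0; first by rewrite mul0mx.
have wh0 : w *m h != 0.
  by apply: contra_neq w0 => wh; rewrite -[w](mulmxK Uh) wh mul0mx.
split=> [swh|sw].
(* This direction uses that [g] maps the fundamental tensors onto themselves: the preimage of a
   fundamental tensor is one again. *)
- have [gU Gf] := Gg.
  have : fundamental_tensors (ten (v^T *m w) *m g).
    by apply/fundamentalP; exists (v *m A^T), (w *m h); split=> //; rewrite -vhE.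
  rewrite -Gf => -[t' /fundamentalP[v' [w' [v'0 w'0 sw' tE]]]] t'E.
  have {}t'E : t' = ten (v^T *m w) by rewrite -(mulmxK gU t') t'E mulmxK.
  move: tE; rewrite t'E tenK => /(outer_uniq v0)[c' ->].
  by rewrite /singular_row linearZ det_scale2.
- have [a [b' [_ _ sb]]] := gfun_fund v0 w0 sw.
  rewrite vhE => /(outer_uniq vA)[c' ->].
  by rewrite /singular_row linearZ det_scale2.
Qed.

End Factorization.

(** * Orbits and their invariants *)

Section Groups.
Variable F : fieldType.
Implicit Types (g : 'M[F]_(2 * 2 * 3)).

Lemma groupG1 : groupG F 1%:M.
Proof.
split; first exact: unitmx1.
by apply/seteqP; split=> [_ [t ft <-]|t ft]; [|exists t]; rewrite ?mulmx1.
Qed.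

Lemma groupGM g h : groupG F g -> groupG F h -> groupG F (g *m h).
Proof.
move=> [Ug Eg] [Uh Eh]; split; first by rewrite unitmx_mul Ug.
rewrite -[RHS]Eh -{2}Eg; apply/seteqP; split=> [_ [t ft <-]|_ [_ [t ft <-] <-]].
  by exists (t *m g); [exists t|rewrite mulmxA].
by exists t => //; rewrite mulmxA.
Qed.

Lemma groupGV g : groupG F g -> groupG F (invmx g).
Proof.
move=> [Ug Eg]; split; first by rewrite unitmx_inv.
rewrite -{1}Eg; apply/seteqP; split=> [_ [_ [t ft <-] <-]|t ft]; rewrite ?mulmxK //.
by exists (t *m g); [exists t|rewrite mulmxK].
Qed.

Lemma groupH1 : groupH F 1%:M.
Proof.
split; first exact: unitmx1.
by exists 1%:M, 1%:M, 1%:M; split; rewrite ?unitmx1 // => *; rewrite !mulmx1.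
Qed.

Lemma groupHM g h : groupH F g -> groupH F h -> groupH F (g *m h).
Proof.
move=> [Ug [g1 [g2 [g3 [u1 u2 u3 Eg]]]]] [Uh [h1 [h2 [h3 [w1 w2 w3 Eh]]]]].
split; first by rewrite unitmx_mul Ug.
exists (g1 *m h1), (g2 *m h2), (g3 *m h3).
by split=> [|||v1 v2 v3]; rewrite ?unitmx_mul ?u1 ?u2 ?u3 // !mulmxA Eg Eh.
Qed.

Lemma groupHV g : groupH F g -> groupH F (invmx g).
Proof.
move=> [Ug [g1 [g2 [g3 [u1 u2 u3 Eg]]]]]; split; first by rewrite unitmx_inv.
exists (invmx g1), (invmx g2), (invmx g3).
split=> [|||v1 v2 v3]; rewrite ?unitmx_inv //.
rewrite -{1}[v1](mulmxKV u1) -{1}[v2](mulmxKV u2) -{1}[v3](mulmxKV u3).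
by rewrite -Eg mulmxK.
Qed.

Lemma pure_delta (i j : 'I_2) (k : 'I_3) :
  'e_(mxtens_index (mxtens_index (i, j), k)) = pure_tensor 'e_i 'e_j 'e_k :> 'rV[F]__.
Proof.
apply/rowP=> q; case: (mxtens_indexP q) => p l; case: (mxtens_indexP p) => i' j'.
rewrite pure_tensorE !mxE !eqxx /= (inj_eq (can_inj (@mxtens_indexK _ _))).
rewrite xpair_eqE (inj_eq (can_inj (@mxtens_indexK _ _))) xpair_eqE.
by do 3!case: eqP => _; rewrite /= ?mul0r ?mulr0 ?mulr1.
Qed.

(** [g] is determined by its values on products of basis vectors, which form the standard basis. *)
Lemma groupH_is_tens g : groupH F g ->
  exists (g1 g2 : 'M[F]_2) (g3 : 'M[F]_3),
    [/\ g1 \in unitmx, g2 \in unitmx, g3 \in unitmx & g = g1 *t g2 *t g3].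
Proof.
move=> [_ [g1 [g2 [g3 [u1 u2 u3 Eg]]]]]; exists g1, g2, g3; split=> //.
apply/row_matrixP=> q; rewrite !rowE.
case: (mxtens_indexP q) => p k; case: (mxtens_indexP p) => i j.
rewrite pure_delta Eg /pure_tensor -['e_i *m g1 *t _]tensmx_mul.
pose ei : 'rV[F]_2 := 'e_i; pose ej : 'rV[F]_2 := 'e_j; pose ek : 'rV[F]_3 := 'e_k.
exact (esym (tensmx_mul (ei *t ej) ek (g1 *t g2) g3)).
Qed.

End Groups.

(** * Counting the orbits of a group of matrices by representatives and an invariant *)

Section Orbits.
Variables (F : fieldType) (A : set 'M[F]_(2 * 2 * 3)).
Hypotheses (A1 : A 1%:M) (AU : A `<=` [set g | g \in unitmx])
  (AM : forall g h, A g -> A h -> A (g *m h)) (AV : forall g, A g -> A (invmx g)).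

Lemma orbit_of_refl t : orbit_of A t t.
Proof. by exists 1%:M => //; rewrite mulmx1. Qed.

Lemma orbit_of_sym t s : orbit_of A t s -> orbit_of A s t.
Proof.
by move=> [g Ag <-]; exists (invmx g); [exact: AV|rewrite mulmxK //; exact: AU].
Qed.

Lemma orbit_of_trans t s r : orbit_of A t s -> orbit_of A s r -> orbit_of A t r.
Proof.
by move=> [g Ag <-] [h Ah <-]; exists (g *m h); [exact: AM|rewrite mulmxA].
Qed.

(** Completeness of the list makes indices map onto orbits; distinct values of the invariant make
    this map injective. *)
Lemma card_orbits (code : 'rV[F]_(2 * 2 * 3) -> nat) (R : seq 'rV[F]_(2 * 2 * 3)) :
  (forall g t, A g -> code (t *m g) = code t) ->
  (forall t, exists2 s, s \in R & orbit_of A t s) -> uniq (map code R) ->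
  (orbits A #= `I_(size R))%card.
Proof.
move=> codeA AR Runiq.
have -> : orbits A = (fun i => orbit_of A (nth 0 R i)) @` `I_(size R).
  apply/seteqP; split=> [_ [t _ <-]|_ [i _ <-]]; last by exists (nth 0 R i).
  have [s sR ts] := AR t; exists (index s R); first by rewrite /= index_mem.
  rewrite nth_index //; apply/seteqP; split=> r.
    exact: orbit_of_trans.
  exact/orbit_of_trans/orbit_of_sym.
apply: inj_card_eq => i j; rewrite !inE => iR jR e.
have : orbit_of A (nth 0 R i) (nth 0 R j) by rewrite e; exact: orbit_of_refl.
move=> [g Ag ij]; apply/eqP; rewrite -(nth_uniq 0 _ _ Runiq) ?size_map //.
by rewrite !(nth_map 0) // -ij codeA.
Qed.

End Orbits.

(** * Invariants of the span of the slices *)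

Section Invariants.
Variable F : fieldType.
Implicit Types (t s : 'rV[F]_(2 * 2 * 3)) (X Y Z M : 'M[F]_2).

Definition in_span t X := (flat X <= mat t)%MS.

Definition all_singular t := forall X, in_span t X -> \det X = 0.

Definition isotropic t := exists X, [/\ X != 0, in_span t X & \det X = 0].

(* A singular point of the restriction of the cone det = 0 to the span. *)
Definition has_vertex t := exists X, [/\ X != 0, in_span t X &
  forall Y, in_span t Y -> \det Y = 0 -> \det (X + Y) = 0].

(** Tells [e_1 (x) F^2] from [F^2 (x) e_1]. It is only an H-invariant, since transposition exchanges
    left and right kernels. *)
Definition left_kernel t := exists2 x : 'rV[F]_2, x != 0 &
  forall X, in_span t X -> x *m X = 0.

(** Projectively, the span is compared with the quadric [det = 0]: a point on or off it; a line
    contained in it (3), external (8), tangent (4) or secant (5); a plane tangent to it (6) or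
    cutting it in a conic (7). *)
Definition codeG t : nat :=
  match \rank (mat t) with
  | 0 => 0
  | 1 => if `[< all_singular t >] then 1 else 2
  | 2 => if `[< all_singular t >] then 3 else
         if `[< ~ isotropic t >] then 8 else
         if `[< has_vertex t >] then 4 else 5
  | _ => if `[< has_vertex t >] then 6 else 7
  end.

(** The contained lines without left kernel take the value 8, and the external lines move to 9. *)
Definition codeH t : nat :=
  let c := codeG t in
  if c == 8 then 9 else if (c == 3) && `[< ~ left_kernel t >] then 8 else c.

Lemma rank_mul_units (A : 'M[F]_3) T (h : 'M[F]_(2 * 2)) :
  A \in unitmx -> h \in unitmx -> \rank (A *m T *m h) = \rank T.
Proof.
by move=> UA Uh; rewrite mxrankMfree ?row_free_unit // eqmxMfull ?row_full_unit.
Qed.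

(** In the factorization of [g], the invertible factor on the left keeps the row space, and the
    factor on the right is the map [f]. *)
Lemma groupG_span g : groupG F g ->
  exists f : {linear 'M[F]_2 -> 'M[F]_2},
  [/\ forall t, \rank (mat (t *m g)) = \rank (mat t),
      forall t X, in_span (t *m g) (f X) <-> in_span t X,
      forall X, \det (f X) = 0 <-> \det X = 0, injective f &
      forall Y, exists X, Y = f X].
Proof.
move=> Gg; have [A [h [UA Uh Eg sg]]] := stabiliser_factor Gg.
exists (@sq F \o mulmxr h \o @flat F); split=> /= [t|t X|X|X Y /(can_inj (@sqK F))|Y].
- by rewrite Eg rank_mul_units.
- rewrite /in_span sqK Eg submxMfree ?row_free_unit //.
  by rewrite (eqmxMfull (mat t)) ?row_full_unit.
- by have := sg (flat X); rewrite /singular_row flatK.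
- by move/(can_inj (mulmxK Uh))/(can_inj (@flatK F)).
- by exists (sq (flat Y *m invmx h)); rewrite sqK mulmxKV // flatK.
Qed.

(** One implication suffices because the group contains inverses. *)
Lemma groupG_invariant (P : 'rV[F]_(2 * 2 * 3) -> Prop) :
  (forall g t, groupG F g -> P t -> P (t *m g)) ->
  forall g t, groupG F g -> `[< P (t *m g) >] = `[< P t >].
Proof.
move=> PG g t Gg; apply: asbool_equiv_eq; split; last exact: PG.
have [Ug _] := Gg.
by move/(PG _ _ (groupGV Gg)); rewrite mulmxK.
Qed.

Lemma codeG_invariant g t : groupG F g -> codeG (t *m g) = codeG t.
Proof.
move=> Gg; have [f [rE _ _ _ _]] := groupG_span Gg.
rewrite /codeG rE.
rewrite (groupG_invariant (P := all_singular)) //; last first.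
  move=> {f rE Gg}{}g {}t /groupG_span[f [_ fs fd _ f_onto]] tP Y.
  by have [X ->] := f_onto Y => /fs/tP/fd.
rewrite (groupG_invariant (P := fun t => ~ isotropic t)) //; last first.
  move=> {f rE Gg}{}g {}t /groupG_span[f [_ fs fd f_inj f_onto]] tP [Y []].
  have [X ->] := f_onto Y => f0 /fs tX /fd dX; apply: tP; exists X; split=> //.
  by apply: contra_neq f0 => ->; rewrite linear0.
rewrite (groupG_invariant (P := has_vertex)) //.
move=> {f rE Gg}{}g {}t /groupG_span[f [_ fs fd f_inj f_onto]] [X [X0 tX XP]].
exists (f X); split; last 1 first.
- move=> Y; have [Z ->] := f_onto Y => /fs tZ /fd dZ; rewrite -linearD; apply/fd.
  exact: XP.
- by apply: contra_neq X0 => f0; apply: f_inj; rewrite f0 linear0.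
- exact/fs.
Qed.

Lemma left_kernel_groupH g t : groupH F g -> left_kernel t -> left_kernel (t *m g).
Proof.
move=> /groupH_is_tens[g1 [g2 [g3 [u1 u2 u3 ->]]]] [x x0 xP].
exists (x *m invmx g1^T) => [|Y /submxP[D]].
  apply: contra_neq x0 => x0.
  by rewrite -[x](mulmxKV (_ : g1^T \in unitmx)) ?x0 ?mul0mx ?unitmx_tr.
rewrite mat_tens !mulmxA => YE; set w := D *m _ *m _ in YE.
rewrite -[Y]flatK YE sq_tens !mulmxA mulmxKV ?unitmx_tr // xP ?mul0mx //.
by rewrite /in_span sqK submxMl.
Qed.

Lemma codeH_invariant g t : groupH F g -> codeH (t *m g) = codeH t.
Proof.
move=> Hg; rewrite /codeH codeG_invariant; last exact: groupH_subG.
suff -> : `[< ~ left_kernel (t *m g) >] = `[< ~ left_kernel t >] by [].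
apply: asbool_equiv_eq; split=> nk kt; apply: nk; first exact: left_kernel_groupH.
have [Ug _] := Hg.
by rewrite -(mulmxK Ug t); apply: left_kernel_groupH; first exact: groupHV.
Qed.

End Invariants.

(** * Representatives and classification *)

Section Representatives.
Variable F : fieldType.
Implicit Types (t s : 'rV[F]_(2 * 2 * 3)) (X Y Z M P Q : 'M[F]_2).

Definition tri X Y Z : 'rV[F]_(2 * 2 * 3) :=
  ten (\matrix_(k < 3) flat (nth 0 [:: X; Y; Z] k)).

Lemma mat_tri X Y Z k : row k (mat (tri X Y Z)) = flat (nth 0 [:: X; Y; Z] k).
Proof. by rewrite tenK rowK. Qed.

Lemma in_span_tri X Y Z M :
  in_span (tri X Y Z) M <-> exists x y z, M = x *: X + y *: Y + z *: Z.
Proof.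
have E (v : 'rV[F]_3) : v *m mat (tri X Y Z) =
    flat (v 0 0 *: X + v 0 1 *: Y + v 0 2%:R *: Z).
  by rewrite mulmx_sum_row sum_ord3 !mat_tri !linearD !linearZ.
split=> [/submxP[v]|[x [y [z ->]]]].
  by rewrite E => /(can_inj (@flatK F)) ->; do 3!eexists.
apply/submxP; exists (\row_k nth 0 [:: x; y; z] k).
by rewrite E !mxE.
Qed.

(** By equality of ranks, the inclusion of the transformed span in that of [t] is an equality, and
    two matrices with the same row space differ by an invertible row operation, that is, by an
    element of [GL_3]. *)
Lemma tri_equiv t X Y Z P Q :
  \rank (mat t) = \rank (mat (tri X Y Z)) -> P \in unitmx -> Q \in unitmx ->
  in_span t (P *m X *m Q) -> in_span t (P *m Y *m Q) -> in_span t (P *m Z *m Q) ->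
  orbit_of (groupH F) t (tri X Y Z).
Proof.
move=> rE UP UQ tX tY tZ; set s := tri X Y Z in rE *.
have UPQ : P^T *t Q \in unitmx by rewrite tensmx_unit // unitmx_tr.
have st : (mat s *m (P^T *t Q) <= mat t)%MS.
  apply/row_subP; have E M : flat M *m (P^T *t Q) = flat (P *m M *m Q).
    by rewrite -[LHS]sqK sq_tens flatK trmxK.
  by apply: forall_ord3; rewrite row_mul mat_tri E.
have /eqmxMunitP[R UR RE] : (mat s *m (P^T *t Q) == mat t)%MS.
  by rewrite -(mxrank_leqif_eq st) mxrankMfree ?row_free_unit // rE.
apply: orbit_of_sym; [by move=> ? []|exact: groupHV|].
exists (P^T *t Q *t (invmx R)^T).
  by apply: groupH_tens; rewrite ?unitmx_tr ?unitmx_inv.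
by apply: (can_inj (@matK F)); rewrite mat_tens trmxK -mulmxA RE mulKmx.
Qed.

(** [p] locates pivots: on these entries the first [r] matrices form an identity pattern, which
    bounds the rank below; the others vanish, which bounds it above. *)
Lemma rank_tri X Y Z (p : 'I_3 -> 'I_2 * 'I_2) r : (r <= 3)%N ->
  (forall k l : 'I_3, (l < r)%N ->
     nth 0 [:: X; Y; Z] k (p l).1 (p l).2 = ((k == l) && (k < r)%N)%:R) ->
  (forall k : 'I_3, (r <= k)%N -> nth 0 [:: X; Y; Z] k = 0) ->
  \rank (mat (tri X Y Z)) = r.
Proof.
move=> r3 Hp H0; set T := mat _.
have TE : T = pid_mx r *m T.
  apply/row_matrixP=> k; rewrite row_mul mulmx_sum_row (bigD1 k) //= big1 => [|l lk].
    rewrite !mxE eqxx /= addr0; case: ltnP => rk; first by rewrite scale1r.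
    by rewrite mat_tri H0 // linear0 scaler0.
  have /negbTE kl : (l : nat) != k by exact: lk.
  by rewrite !mxE eq_sym kl scale0r.
apply/eqP; rewrite eqn_leq; apply/andP; split.
  by rewrite TE; apply: leq_trans (mxrankM_maxl _ _) _; rewrite rank_pid_mx.
rewrite -{1}(@rank_pid_mx F 3 3 r r3 r3).
(* The right factor selects the pivot columns. *)
have -> : pid_mx r = T *m (\matrix_(q, l) ((q == mxtens_index (p l)) && (l < r)%N)%:R).
  apply/matrixP=> k l; rewrite [RHS]mxE (bigD1 (mxtens_index (p l))) //= big1 => [|q ql].
    have /rowP/(_ (mxtens_index (p l))) := mat_tri X Y Z k; rewrite -/T !mxE => ->.
    rewrite mxtens_indexK eqxx addr0 /=; case: (ltnP l r) => [lr|rl].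
      by rewrite Hp // mulr1.
    rewrite mulr0; case: eqP => // kl; rewrite (_ : (k < r)%N = false) //.
    by rewrite kl ltnNge rl.
  by rewrite [X in _ * X]mxE (negbTE ql) mulr0.
exact: mxrankM_maxl.
Qed.

Definition E11 : 'M[F]_2 := mx2 1 0 0 0.
Definition E12 : 'M[F]_2 := mx2 0 1 0 0.
Definition E21 : 'M[F]_2 := mx2 0 0 1 0.
Definition E22 : 'M[F]_2 := mx2 0 0 0 1.

Definition rep_zero := tri 0 0 0.
Definition rep_point := tri E11 0 0.
Definition rep_nonsing := tri (mx2 1 0 0 1) 0 0.
Definition rep_row := tri E11 E12 0.
Definition rep_col := tri E11 E21 0.
Definition rep_tangent := tri E11 (mx2 0 1 1 0) 0.
Definition rep_secant := tri E11 E22 0.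
(** This plane and the next are the orthogonals of [E11] and of the identity for the trace form. *)
Definition rep_tangent_plane := tri E12 E21 E22.
Definition rep_conic_plane := tri E12 E21 (mx2 1 0 0 (-1)).
(** The second generator is the companion matrix with trace [s] and determinant [n]. *)
Definition rep_external (s n : F) := tri (mx2 1 0 0 1) (mx2 0 1 (- n) s) 0.

Ltac rank_tac p := apply: (@rank_tri _ _ _ p);
  [by [] | do 2!apply: forall_ord3; rewrite ?mxE | apply: forall_ord3 => //].

Definition pos (a b c : 'I_2 * 'I_2) (l : 'I_3) := nth a [:: a; b; c] l.

Lemma rank_zero : \rank (mat rep_zero) = 0.
Proof. by rank_tac (pos (0, 0) (0, 0) (0, 0)). Qed.
Lemma rank_point : \rank (mat rep_point) = 1.
Proof. by rank_tac (pos (0, 0) (1, 1) (1, 1)). Qed.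
Lemma rank_nonsing : \rank (mat rep_nonsing) = 1.
Proof. by rank_tac (pos (0, 0) (0, 1) (0, 1)). Qed.
Lemma rank_row : \rank (mat rep_row) = 2.
Proof. by rank_tac (pos (0, 0) (0, 1) (1, 1)). Qed.
Lemma rank_col : \rank (mat rep_col) = 2.
Proof. by rank_tac (pos (0, 0) (1, 0) (1, 1)). Qed.
Lemma rank_tangent : \rank (mat rep_tangent) = 2.
Proof. by rank_tac (pos (0, 0) (0, 1) (1, 1)). Qed.
Lemma rank_secant : \rank (mat rep_secant) = 2.
Proof. by rank_tac (pos (0, 0) (1, 1) (0, 1)). Qed.
Lemma rank_tangent_plane : \rank (mat rep_tangent_plane) = 3.
Proof. by rank_tac (pos (0, 1) (1, 0) (1, 1)). Qed.
Lemma rank_conic_plane : \rank (mat rep_conic_plane) = 3.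
Proof. by rank_tac (pos (0, 1) (1, 0) (0, 0)). Qed.
Lemma rank_external (s n : F) : \rank (mat (rep_external s n)) = 2.
Proof. by rank_tac (pos (0, 0) (0, 1) (1, 1)). Qed.
End Representatives.

(** * Values of the invariants on the representatives *)

Section Codes.
Variable F : fieldType.
Implicit Types (t : 'rV[F]_(2 * 2 * 3)) (X Y Z M P Q : 'M[F]_2).

Lemma span_tri1 X Y Z : in_span (tri X Y Z) X.
Proof. by apply/in_span_tri; exists 1, 0, 0; rewrite scale1r !scale0r !addr0. Qed.

Lemma span_tri2 X Y Z : in_span (tri X Y Z) Y.
Proof. by apply/in_span_tri; exists 0, 1, 0; rewrite scale1r !scale0r addr0 add0r. Qed.

Lemma in_span0 t : in_span t 0.
Proof. by rewrite /in_span linear0 sub0mx. Qed.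

Lemma in_spanD t X Y : in_span t X -> in_span t Y -> in_span t (X + Y).
Proof. by rewrite /in_span linearD; apply: addmx_sub. Qed.

Lemma in_spanZ t c X : in_span t X -> in_span t (c *: X).
Proof. by rewrite /in_span linearZ; apply: scalemx_sub. Qed.

Lemma mx2_neq0 (a b c d : F) :
  (mx2 a b c d != 0) = ~~ [&& a == 0, b == 0, c == 0 & d == 0].
Proof.
rewrite mx2_0; congr (~~ _); apply/eqP/and4P => [/mx2_eq[-> -> -> ->]|].
  by rewrite eqxx.
by move=> [/eqP-> /eqP-> /eqP-> /eqP->].
Qed.

Ltac unfold_mx := rewrite /E11 /E12 /E21 /E22 ?mx2_0 ?mx2_calc.
Ltac det_neq0 :=
  unfold_mx; rewrite ?(mulr1, mul1r, mulr0, mul0r, subr0, sub0r, addr0, add0r) => /eqP;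
  rewrite ?oppr_eq0 oner_eq0.

Lemma codeG_zero : codeG (rep_zero F) = 0.
Proof. by rewrite /codeG rank_zero. Qed.

Lemma codeG_point : codeG (rep_point F) = 1.
Proof.
rewrite /codeG rank_point asboolT // => X /in_span_tri[x [y [z ->]]].
by unfold_mx; ring.
Qed.

Lemma codeG_nonsing : codeG (rep_nonsing F) = 2.
Proof.
rewrite /codeG rank_nonsing asboolF // => /(_ _ (span_tri1 _ _ _)).
by det_neq0.
Qed.

Lemma codeG_row : codeG (rep_row F) = 3.
Proof.
rewrite /codeG rank_row asboolT // => X /in_span_tri[x [y [z ->]]].
by unfold_mx; ring.
Qed.

Lemma codeG_col : codeG (rep_col F) = 3.
Proof.
rewrite /codeG rank_col asboolT // => X /in_span_tri[x [y [z ->]]].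
by unfold_mx; ring.
Qed.

Lemma codeG_tangent : codeG (rep_tangent F) = 4.
Proof.
(* On this span [det] is [- y^2], with [y] the coefficient of the second generator, so adding [E11]
   does not change it. *)
have E11_vertex : has_vertex (rep_tangent F).
  exists (E11 F); split; [by rewrite mx2_neq0 oner_eq0|exact: span_tri1|].
  move=> Y /in_span_tri[x [y [z ->]]] d0; rewrite -[RHS]d0.
  by unfold_mx; ring.
rewrite /codeG rank_tangent asboolF.
  rewrite asboolF; first by rewrite asboolT.
  apply; have [X [X0 tX XP]] := E11_vertex; exists X; split=> //.
  by have := XP _ (in_span0 _) (det0 _ _); rewrite addr0.
by move/(_ _ (span_tri2 _ _ _)); det_neq0.
Qed.

Lemma codeG_secant : codeG (rep_secant F) = 5.
Proof.
rewrite /codeG rank_secant !asboolF //.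
- move=> [X [X0 /in_span_tri[x [y [z XE]]] XP]]; move: X0; rewrite {}XE in XP *.
  (* Here [det] is [x y]; the vertex property at 0, [E11] and [E22] gives three equations whose
     differences force [x = y = 0]. *)
  have := XP _ (in_span0 _) (det0 _ _).
  have := XP _ (span_tri1 _ _ _) _; have := XP _ (span_tri2 _ _ _) _.
  unfold_mx; rewrite -mx2_0 mx2_neq0 !(mulr1, mulr0, mul0r, addr0, subr0, add0r, oppr0).
  move=> /(_ erefl) e1 /(_ erefl) e2 e3; case/negP; rewrite !eqxx /=.
  have x0 : x = 0 by transitivity (x * (y + 1) - x * y); [ring|rewrite e1 e3 subr0].
  have y0 : y = 0 by transitivity ((x + 1) * y - x * y); [ring|rewrite e2 e3 subr0].
  by rewrite x0 y0 eqxx.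
- apply; exists (E11 F); split; [by rewrite mx2_neq0 oner_eq0|exact: span_tri1|].
  by unfold_mx; ring.
- by move/(_ _ (in_spanD (span_tri1 _ _ _) (span_tri2 _ _ _))); det_neq0.
Qed.

Lemma codeG_tangent_plane : codeG (rep_tangent_plane F) = 6.
Proof.
rewrite /codeG rank_tangent_plane /= asboolT //; exists (E22 F); split.
- by rewrite mx2_neq0 oner_eq0 !andbF.
- by apply/in_span_tri; exists 0, 0, 1; rewrite scale1r !scale0r !add0r.
- move=> Y /in_span_tri[x [y [z ->]]] d0; rewrite -[RHS]d0.
  by unfold_mx; ring.
Qed.

Lemma codeG_conic_plane : codeG (rep_conic_plane F) = 7.
Proof.
rewrite /codeG rank_conic_plane /= asboolF // => -[X [X0 /in_span_tri[x [y [z XE]]] XP]].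
move: X0; rewrite {}XE in XP *.
(* Here [det] is [- z^2 - x y]; the cases 0, [E12], [E21] give [x = y = 0] by differences, and then
   the case 0 gives [z = 0]. Nothing is divided by 2, so characteristic two is covered. *)
have := XP _ (in_span0 _) (det0 _ _).
have := XP _ (span_tri1 _ _ _) _; have := XP _ (span_tri2 _ _ _) _.
unfold_mx; rewrite -mx2_0 mx2_neq0 !(mulr1, mulr0, mul0r, addr0, subr0, add0r, oppr0).
move=> /(_ erefl) e1 /(_ erefl) e2 e3.
have x0 : x = 0.
  by transitivity ((z * (z * -1) - x * y) - (z * (z * -1) - x * (y + 1)));
    [ring|rewrite e1 e3 subr0].
have y0 : y = 0.
  by transitivity ((z * (z * -1) - x * y) - (z * (z * -1) - (x + 1) * y));
    [ring|rewrite e2 e3 subr0].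
move: e3; rewrite x0 y0 mul0r subr0 mulrN1 mulrN => /eqP.
by rewrite oppr_eq0 mulf_eq0 orbb => /eqP ->; rewrite oppr0 eqxx.
Qed.

Lemma codeG_external (s n : F) : rootless s n -> codeG (rep_external s n) = 8.
Proof.
move=> rl; rewrite /codeG rank_external asboolF.
  rewrite asboolT // => -[X [X0 /in_span_tri[x [y [z XE]]]]].
  move: X0; rewrite {}XE; unfold_mx => X0 d0.
  have [x0 y0] : x = 0 /\ y = 0 by apply: (rootless_norm rl); rewrite -[RHS]d0; ring.
  by move: X0; rewrite x0 y0 -mx2_0 mx2_neq0 !(mul0r, mulr0, addr0) eqxx.
by move/(_ _ (span_tri1 _ _ _)); det_neq0.
Qed.

Lemma codeH_row : codeH (rep_row F) = 3.
Proof.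
rewrite /codeH codeG_row /= asboolF //; apply.
exists 'e_1; first exact: delta_row_neq0.
move=> X /in_span_tri[x [y [z ->]]]; unfold_mx.
apply/rowP; apply: forall_ord2; rewrite !mxE sum_ord2 !mxE /=; ring.
Qed.

Lemma codeH_col : codeH (rep_col F) = 8.
Proof.
rewrite /codeH codeG_col /= asboolT // => -[x + xP].
have := xP _ (span_tri1 _ _ _); have := xP _ (span_tri2 _ _ _).
move=> /rowP/(_ 0) + /rowP/(_ 0); rewrite !mxE !sum_ord2 !mxE /=.
rewrite !(mulr1, mulr0, addr0, add0r) => x1 x0 /eqP; apply.
by apply/rowP; apply: forall_ord2; rewrite mxE.
Qed.

(** Listed in the order of their codes. [rep_col] is kept apart because G fuses it with
    [rep_row]. *)
Definition repsG := [:: rep_zero F; rep_point F; rep_nonsing F; rep_row F;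
  rep_tangent F; rep_secant F; rep_tangent_plane F; rep_conic_plane F].

Lemma repsG_codeG : map (@codeG F) repsG = iota 0 8.
Proof.
by rewrite /= codeG_zero codeG_point codeG_nonsing codeG_row codeG_tangent
  codeG_secant codeG_tangent_plane codeG_conic_plane.
Qed.

Lemma repsG_codeH : map (@codeH F) repsG = iota 0 8.
Proof.
by rewrite /= codeH_row /codeH codeG_zero codeG_point codeG_nonsing codeG_tangent
  codeG_secant codeG_tangent_plane codeG_conic_plane.
Qed.

End Codes.

(** * Reduction of every tensor to a representative *)

Section Classification.
Variable F : fieldType.
Implicit Types (t : 'rV[F]_(2 * 2 * 3)) (X Y Z M P Q : 'M[F]_2).

Lemma mx2_unit (a b c d : F) : (mx2 a b c d \in unitmx) = (a * d - b * c != 0).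
Proof. by rewrite unitmxE det_mx2 unitfE. Qed.

Lemma pid1_mx2 : pid_mx 1 = E11 F.
Proof. by apply/matrixP; do 2!apply: forall_ord2; rewrite !mxE. Qed.

Lemma mx2_singularP X : X != 0 -> \det X = 0 ->
  exists P Q, [/\ P \in unitmx, Q \in unitmx & X = P *m E11 F *m Q].
Proof.
move=> X0 d0; exists (col_ebase X), (row_ebase X).
rewrite col_ebase_unit row_ebase_unit -pid1_mx2; split=> //.
by rewrite -{1}[X]mulmx_ebase (rank_singular X0 d0).
Qed.

Lemma mx2_cases X : X != 0 ->
  exists P Q, [/\ P \in unitmx, Q \in unitmx &
    X = P *m E11 F *m Q \/ X = P *m mx2 1 0 0 1 *m Q].
Proof.
move=> X0; have [d0|d0] := eqVneq (\det X) 0.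
  have [P [Q [UP UQ ->]]] := mx2_singularP X0 d0.
  by exists P, Q; split=> //; left.
exists X, 1%:M; rewrite unitmx1 unitmxE unitfE d0; split=> //; right.
by rewrite -mx2_1 !mulmx1.
Qed.

Lemma not_span m t (u : 'M[F]_(m, 2 * 2)) : ~~ (mat t <= u)%MS ->
  exists2 X, in_span t X & ~~ (flat X <= u)%MS.
Proof.
move=> /row_subPn[k nk]; exists (sq (row k (mat t))); rewrite /in_span sqK //.
exact: row_sub.
Qed.

Lemma in_span_mul t P1 P2 Q1 Q2 M :
  in_span t (P1 *m (P2 *m M *m Q2) *m Q1) -> in_span t (P1 *m P2 *m M *m (Q2 *m Q1)).
Proof. by rewrite !mulmxA. Qed.

Lemma in_span_mul_comb t P Q X Y x y :
  in_span t (P *m X *m Q) -> in_span t (P *m Y *m Q) ->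
  in_span t (P *m (x *: X + y *: Y) *m Q).
Proof.
move=> tX tY; rewrite mulmxDr mulmxDl -!scalemxAr -!scalemxAl.
by apply: in_spanD; apply: in_spanZ.
Qed.

Lemma classify_rank0 t : \rank (mat t) = 0%N -> orbit_of (groupH F) t (rep_zero F).
Proof.
move=> r0; apply: (@tri_equiv _ _ _ _ _ 1%:M 1%:M); rewrite ?unitmx1 ?rank_zero ?r0 //.
all: by rewrite mulmx0 mul0mx in_span0.
Qed.

Lemma classify_rank1 t : \rank (mat t) = 1%N ->
  orbit_of (groupH F) t (rep_point F) \/ orbit_of (groupH F) t (rep_nonsing F).
Proof.
move=> r1; have [X tX X0] : exists2 X, in_span t X & X != 0.
  have [|X tX] := @not_span _ t (0 : 'M_(2 * 2)); first by rewrite submx0 -mxrank_eq0 r1.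
  by rewrite submx0 flat_eq0; exists X.
have [P [Q [UP UQ [] XE]]] := mx2_cases X0; [left|right].
  by apply: (tri_equiv _ UP UQ); rewrite ?r1 ?rank_point -?XE ?mulmx0 ?mul0mx ?in_span0.
by apply: (tri_equiv _ UP UQ); rewrite ?r1 ?rank_nonsing -?XE ?mulmx0 ?mul0mx ?in_span0.
Qed.

(** With one generator moved to [E11], the other, with entries [a b c d], matters modulo [E11]:
    [d != 0] is the secant case; if [d = 0], the case depends on which of [b], [c] vanish. *)
Lemma classify_isotropic t : \rank (mat t) = 2%N -> isotropic t ->
  [\/ orbit_of (groupH F) t (rep_row F), orbit_of (groupH F) t (rep_col F),
      orbit_of (groupH F) t (rep_tangent F) | orbit_of (groupH F) t (rep_secant F)].
Proof.
move=> r2 [X [X0 tX dX]].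
have [Y tY nY] : exists2 Y, in_span t Y & ~~ (flat Y <= flat X)%MS.
  by apply: not_span; apply/negP=> /mxrankS; rewrite r2 leqNgt ltnS rank_leq_row.
have [P [Q [UP UQ XE]]] := mx2_singularP X0 dX.
have [a [b [c [d YE]]]] := mx2P (invmx P *m Y *m invmx Q).
have {}YE : Y = P *m mx2 a b c d *m Q by rewrite -YE !mulmxA mulmxV // mul1mx mulmxKV.
have span x y : in_span t (P *m (x *: E11 F + y *: mx2 a b c d) *m Q).
  by apply: in_span_mul_comb; rewrite -?XE -?YE.
have {}span e f g h x y : mx2 e f g h = x *: E11 F + y *: mx2 a b c d ->
    in_span t (P *m mx2 e f g h *m Q) by move->; apply: span.
have sp0 P' Q' : in_span t (P' *m 0 *m Q') by rewrite mulmx0 mul0mx in_span0.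
have [d0|d0] := eqVneq d 0; last first.
  (* These fix [E11] and send [E22] to the outer product of [(b/d, 1)] and [(c/d, 1)], which differs
     from the second generator divided by [d] by a multiple of [E11]. *)
  constructor 4; pose P2 := mx2 1 (b / d) 0 1; pose Q2 := mx2 1 0 (c / d) 1.
  apply: (@tri_equiv _ _ _ _ _ (P *m P2) (Q2 *m Q)); rewrite ?r2 ?rank_secant //.
  - by rewrite unitmx_mul UP mx2_unit !(mul1r, mulr0, subr0) oner_eq0.
  - by rewrite unitmx_mul UQ mx2_unit !(mul1r, mul0r, subr0) oner_eq0.
  - apply: in_span_mul; rewrite /E11 /P2 /Q2 !mx2_calc; apply: (span _ _ _ _ 1 0).
    by rewrite /E11 !mx2_calc; apply/mx2_eq; split; ring.
  - apply: in_span_mul; rewrite /E22 /P2 /Q2 !mx2_calc.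
    apply: (span _ _ _ _ (b * c / d ^+ 2 - a / d) d^-1).
    by rewrite /E11 !mx2_calc; apply/mx2_eq; split; field.
have [b0|b0] := eqVneq b 0; have [c0|c0] := eqVneq c 0.
- case/negP: nY; rewrite YE XE b0 c0 d0 (_ : mx2 a 0 0 0 = a *: E11 F).
    by rewrite -scalemxAr -scalemxAl linearZ scalemx_sub.
  by rewrite /E11 !mx2_calc; apply/mx2_eq; split; ring.
- constructor 2; apply: (tri_equiv _ UP UQ); rewrite -?XE ?r2 ?rank_col //.
  apply: (span _ _ _ _ (- a / c) c^-1).
  by rewrite /E11 !mx2_calc d0 b0; apply/mx2_eq; split; field.
- constructor 1; apply: (tri_equiv _ UP UQ); rewrite -?XE ?r2 ?rank_row //.
  apply: (span _ _ _ _ (- a / b) b^-1).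
  by rewrite /E11 !mx2_calc d0 c0; apply/mx2_eq; split; field.
(* These fix [E11] and send [E12 + E21] to [b E12 + c E21]. *)
constructor 3; pose P2 := mx2 1 0 0 c; pose Q2 := mx2 1 0 0 b.
apply: (@tri_equiv _ _ _ _ _ (P *m P2) (Q2 *m Q)); rewrite ?r2 ?rank_tangent //.
- by rewrite unitmx_mul UP mx2_unit !(mul1r, mulr0, subr0).
- by rewrite unitmx_mul UQ mx2_unit !(mul1r, mulr0, subr0) b0.
- apply: in_span_mul; rewrite /E11 /P2 /Q2 !mx2_calc; apply: (span _ _ _ _ 1 0).
  by rewrite /E11 !mx2_calc; apply/mx2_eq; split; ring.
- apply: in_span_mul; rewrite /P2 /Q2 !mx2_calc; apply: (span _ _ _ _ (- a) 1).
  by rewrite /E11 !mx2_calc d0; apply/mx2_eq; split; ring.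
Qed.

Lemma hyperplane_dual t : \rank (mat t) = 3%N ->
  exists2 C, C != 0 & forall X, in_span t X <-> \tr (X^T *m C) = 0.
Proof.
move=> r3; have : kermx (mat t)^T != 0.
  by rewrite -mxrank_eq0 mxrank_ker mxrank_tr r3.
case/rowV0Pn=> u /sub_kermxP uT u0; pose c := u^T.
have Tc : mat t *m c = 0 by rewrite -[mat t]trmxK -trmx_mul uT trmx0.
have cq : c != 0 by rewrite trmx_eq0.
have rc : \rank c = 1%N by rewrite -mxrank_tr rank_rV trmx_eq0 cq.
have /eqmxP tE : (mat t == kermx c)%MS.
  have tk : (mat t <= kermx c)%MS by apply/sub_kermxP.
  by rewrite -(mxrank_leqif_eq tk) mxrank_ker r3 rc.
exists (sq c^T) => [|X]; first by rewrite sq_eq0 trmx_eq0.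
rewrite /in_span tE.
have -> : \tr (X^T *m sq c^T) = (flat X *m c) 0 0.
  rewrite -[c]trmxK -(sqK c^T) dot_flat trmxK sqK /mxtrace exchange_big /=.
  apply: eq_bigr => j _; rewrite mxE; apply: eq_bigr => i _.
  by rewrite flatK !mxE.
split=> [/sub_kermxP ->|e]; first by rewrite mxE.
by apply/sub_kermxP; rewrite [_ *m _]mx11_scalar e raddf0.
Qed.

Lemma classify_rank3 t : \rank (mat t) = 3%N ->
  orbit_of (groupH F) t (rep_tangent_plane F) \/
  orbit_of (groupH F) t (rep_conic_plane F).
Proof.
move=> r3; have [C C0 tC] := hyperplane_dual r3.
have [P [Q [UP UQ CE]]] := mx2_cases C0.
(* If [C = P D Q], the inverse transposes of [P] and [Q] carry the orthogonal of [D] into that of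
   [C]. *)
have tD M D : C = P *m D *m Q -> \tr (M^T *m D) = 0 ->
    in_span t (invmx P^T *m M *m invmx Q^T).
  move=> {}CE e; apply/tC; rewrite CE !trmx_mul !trmx_inv !trmxK.
  by rewrite !mulmxA mulmxKV // mxtrace_mulC !mulmxA mulmxV // mul1mx.
have UP' : invmx P^T \in unitmx by rewrite unitmx_inv unitmx_tr.
have UQ' : invmx Q^T \in unitmx by rewrite unitmx_inv unitmx_tr.
case: CE => CE; [left|right]; apply: (tri_equiv _ UP' UQ').
all: rewrite ?r3 ?rank_tangent_plane ?rank_conic_plane //.
all: apply: (tD _ _ CE).
all: rewrite /E11 /E12 /E21 /E22 tr_mx2 mul_mx2 /mxtrace sum_ord2 !mxE /=; ring.
Qed.

(** Normalising one generator to the identity turns the span into [<1, B>], where [B] may be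
    replaced by any [x + y B] with a rootless polynomial. The choice of [x] and [y] is left open,
    since it depends on the field. *)
Lemma classify_external t : \rank (mat t) = 2%N -> ~ isotropic t ->
  exists s n, rootless s n /\
  forall x y s0 n0, rootless s0 n0 ->
    x *+ 2 + s * y = s0 -> x ^+ 2 + s * x * y + n * y ^+ 2 = n0 ->
    orbit_of (groupH F) t (rep_external s0 n0).
Proof.
move=> r2 ti.
have [A tA A0] : exists2 A, in_span t A & A != 0.
  have [|A tA] := @not_span _ t (0 : 'M_(2 * 2)); first by rewrite submx0 -mxrank_eq0 r2.
  by rewrite submx0 flat_eq0; exists A.
have UA : A \in unitmx.
  by rewrite unitmxE unitfE; apply/eqP=> dA; apply: ti; exists A.
have [Y tY nY] : exists2 Y, in_span t Y & ~~ (flat Y <= flat A)%MS.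
  by apply: not_span; apply/negP=> /mxrankS; rewrite r2 leqNgt ltnS rank_leq_row.
have [a [b [c [d BE]]]] := mx2P (invmx A *m Y).
have {}YE : Y = A *m mx2 a b c d by rewrite -BE mulKVmx.
have span x y : in_span t (A *m (x *: mx2 1 0 0 1 + y *: mx2 a b c d)).
  rewrite -[_ *m _]mulmx1; apply: in_span_mul_comb; rewrite mulmx1 -?YE //.
  by rewrite -mx2_1 mulmx1.
(* Trace and determinant of [A^-1 Y]; a root would produce a nonzero singular combination of [A] and
   [Y]. *)
exists (a + d), (a * d - b * c); split=> [x|x y s0 n0 rl0 sE nE].
  apply/eqP=> e; apply: ti.
  exists (A *m (x *: mx2 1 0 0 1 + 1 *: mx2 a b c d)); split=> //.
    apply: contraNneq nY => /(congr1 (mulmx (invmx A))).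
    rewrite mulKmx // mulmx0 scale1r => /eqP.
    rewrite addrC addr_eq0 => /eqP B0; rewrite YE B0 -mx2_1 -scaleNr -scalemxAr mulmx1.
    by rewrite linearZ scalemx_sub.
  by rewrite det_mulmx (_ : \det (_ + _) = 0) ?mulr0 // !mx2_calc -[RHS]e; ring.
pose B := x *: mx2 1 0 0 1 + y *: mx2 a b c d.
have {}BE : B = mx2 (x + y * a) (y * b) (y * c) (x + y * d).
  by rewrite /B !mx2_calc; apply/mx2_eq; split; ring.
(* Otherwise [B] is lower triangular and its diagonal entry yields a root. *)
have b0 : y * b != 0.
  apply: contraNneq (rl0 (- (x + y * a))) => b0.
  suff -> : (- (x + y * a)) ^+ 2 + s0 * - (x + y * a) + n0 = (y * b) * (- y * c).
    by rewrite b0 mul0r.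
  by rewrite -sE -nE; ring.
(* The rows are [e_0] and [e_0 B], a cyclic basis, in which [B] becomes its companion matrix. *)
pose R := mx2 1 0 (x + y * a) (y * b).
have UR : R \in unitmx by rewrite mx2_unit !(mul1r, mul0r, subr0).
have RB : R *m B = mx2 0 1 (- n0) s0 *m R.
  by rewrite /R BE !mx2_calc -sE -nE; apply/mx2_eq; split; ring.
apply: (@tri_equiv _ _ _ _ _ (A *m invmx R) R).
- by rewrite r2 rank_external.
- by rewrite unitmx_mul UA unitmx_inv.
- by [].
- by rewrite -mx2_1 mulmx1 mulmxKV.
- by rewrite -!mulmxA -RB mulKmx //; apply: span.
- by rewrite mulmx0 mul0mx in_span0.
Qed.

End Classification.

(** * Counting the orbits *)

Section Swap.
Variable F : fieldType.
Implicit Types (t : 'rV[F]_(2 * 2 * 3)) (X Y Z : 'M[F]_2).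

Definition swap_mx : 'M[F]_(2 * 2 * 3) :=
  lin1_mx (@flat F \o trmx \o @sq F) *t 1%:M.

Lemma mat_swap t : mat (t *m swap_mx) = mat t *m lin1_mx (@flat F \o trmx \o @sq F).
Proof. by rewrite mat_tens trmx1 mul1mx. Qed.

Lemma swapK t : t *m swap_mx *m swap_mx = t.
Proof.
apply: (can_inj (@matK F)); rewrite !mat_swap; apply/row_matrixP=> k.
by rewrite !row_mul !mul_rV_lin1 /= flatK trmxK sqK.
Qed.

Lemma swap_tri X Y Z : tri X Y Z *m swap_mx = tri X^T Y^T Z^T.
Proof.
apply: (can_inj (@matK F)); rewrite mat_swap; apply/row_matrixP.
by apply: forall_ord3; rewrite row_mul !mat_tri mul_rV_lin1 /= flatK.
Qed.

Lemma groupG_swap : groupG F swap_mx.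
Proof.
have fund t : fundamental_tensors t -> fundamental_tensors (t *m swap_mx).
  move=> /fundamentalP[v [w [v0 w0 dw tE]]]; apply/fundamentalP.
  exists v, (flat (sq w)^T); split=> //.
  - by rewrite flat_eq0 trmx_eq0 sq_eq0.
  - by rewrite flatK det_tr.
  - by rewrite mat_swap tE -mulmxA mul_rV_lin1.
split; first by apply: (proj1 (mulmx1_unit (_ : swap_mx *m swap_mx = 1%:M)));
  apply/row_matrixP=> q; rewrite !rowE mulmxA swapK mulmx1.
apply/seteqP; split=> [_ [t ft <-]|t ft]; first exact: fund.
by exists (t *m swap_mx); [exact: fund|rewrite swapK].
Qed.

End Swap.

Section Counting.
Variable F : fieldType.
Implicit Types (t : 'rV[F]_(2 * 2 * 3)) (R : seq 'rV[F]_(2 * 2 * 3)).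

Lemma orbit_H_sub_G t s : orbit_of (groupH F) t s -> orbit_of (groupG F) t s.
Proof. by move=> [g /groupH_subG Gg <-]; exists g. Qed.

Lemma orbit_G_col_row : orbit_of (groupG F) (rep_col F) (rep_row F).
Proof.
exists (swap_mx F); first exact: groupG_swap.
by rewrite swap_tri /E11 /E21 !tr_mx2 trmx0.
Qed.

(** The anisotropic case stays open here: it is the only one where the field matters. *)
Lemma classify t :
  (exists2 s, s \in rep_col F :: repsG F & orbit_of (groupH F) t s) \/
  (\rank (mat t) = 2%N /\ ~ isotropic t).
Proof.
have mem s : s \in rep_col F :: repsG F -> orbit_of (groupH F) t s ->
    exists2 s, s \in rep_col F :: repsG F & orbit_of (groupH F) t s by exists s.
have := rank_leq_row (mat t).
case rE: (\rank (mat t)) => [|[|[|[|//]]]] _.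
- by left; apply: mem (classify_rank0 rE); rewrite !inE eqxx ?orbT.
- by left; case: (classify_rank1 rE); apply: mem; rewrite !inE eqxx ?orbT.
- case: (pselect (isotropic t)) => [it|]; last by right.
  by left; case: (classify_isotropic rE it); apply: mem; rewrite !inE eqxx ?orbT.
- by left; case: (classify_rank3 rE); apply: mem; rewrite !inE eqxx ?orbT.
Qed.

Lemma card_orbitsH R : uniq (map (@codeH F) R) ->
  (forall t, exists2 s, s \in R & orbit_of (groupH F) t s) ->
  (orbits (groupH F) #= `I_(size R))%card.
Proof.
move=> uR tR; apply: (card_orbits _ _ _ _ _ tR uR).
- exact: groupH1.
- by move=> ? [].
- exact: groupHM.
- exact: groupHV.
- by move=> g t; apply: codeH_invariant.
Qed.

(** The H-classification is reused: H is contained in G, and the swap sends [rep_col] to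
    [rep_row]. *)
Lemma card_orbitsG R : rep_row F \in R -> uniq (map (@codeG F) R) ->
  (forall t, exists2 s, s \in rep_col F :: R & orbit_of (groupH F) t s) ->
  (orbits (groupG F) #= `I_(size R))%card.
Proof.
move=> rR uR tR; apply: (card_orbits _ _ _ _ _ _ uR).
- exact: groupG1.
- by move=> ? [].
- exact: groupGM.
- exact: groupGV.
- by move=> g t; apply: codeG_invariant.
move=> t; have [s + /orbit_H_sub_G ts] := tR t.
rewrite inE => /predU1P[sE|sR]; last by exists s.
exists (rep_row F) => //; rewrite sE in ts.
by apply: (orbit_of_trans _ ts orbit_G_col_row); exact: groupGM.
Qed.

Lemma card_orbits_no_rootless : (forall s n : F, ~ rootless s n) ->
  (orbits (groupH F) #= `I_9)%card /\ (orbits (groupG F) #= `I_8)%card.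
Proof.
move=> nrl.
have tR t : exists2 s, s \in rep_col F :: repsG F & orbit_of (groupH F) t s.
  have [//|[r2 /(classify_external r2)[s [n [rl _]]]]] := classify t.
  by case: (nrl s n).
split.
- by apply: (card_orbitsH _ tR); rewrite map_cons repsG_codeH codeH_col.
- by apply: (card_orbitsG _ _ tR); rewrite ?repsG_codeG // !inE eqxx !orbT.
Qed.

(** The second hypothesis says that every such [F[B]] contains an element of trace [s0] and norm
    [n0], so all anisotropic spans fall into one orbit. *)
Lemma card_orbits_one_rootless (s0 n0 : F) : rootless s0 n0 ->
  (forall s n : F, rootless s n -> exists x y,
     x *+ 2 + s * y = s0 /\ x ^+ 2 + s * x * y + n * y ^+ 2 = n0) ->
  (orbits (groupH F) #= `I_10)%card /\ (orbits (groupG F) #= `I_9)%card.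
Proof.
move=> rl0 uniq_rl; pose R := rep_external s0 n0 :: repsG F.
have tR t : exists2 s, s \in rep_col F :: R & orbit_of (groupH F) t s.
  have [[s sR ts]|[r2 /(classify_external r2)[s [n [rl te]]]]] := classify t.
    exists s => //; move: sR; rewrite inE => /predU1P[->|sR].
      by rewrite inE eqxx.
    by rewrite !inE in sR *; rewrite sR !orbT.
  have [x [y [sE nE]]] := uniq_rl _ _ rl.
  by exists (rep_external s0 n0); [rewrite !inE eqxx orbT|exact: te rl0 sE nE].
split.
- apply: (card_orbitsH _ tR); rewrite 2!map_cons repsG_codeH codeH_col.
  by rewrite /codeH codeG_external.
- apply: (card_orbitsG _ _ tR); first by rewrite !inE eqxx !orbT.
  by rewrite map_cons repsG_codeG codeG_external.
Qed.

End Counting.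

Local Open Scope card_scope.

Theorem theorem3p10 :
  ((forall F : finFieldType,
      orbits (groupH F) #= `I_10 /\ orbits (groupG F) #= `I_9) /\
   (forall R : realType,
      orbits (groupH R) #= `I_10 /\ orbits (groupG R) #= `I_9)) /\
  (forall F : closedFieldType,
      orbits (groupH F) #= `I_9 /\ orbits (groupG F) #= `I_8).
Proof.
split; first split=> [F|R].
- have [s0 [n0 rl0]] := rootless_exists_finite F.
  apply: (card_orbits_one_rootless rl0) => s n rl; exact: rootless_unique_finite rl rl0.
(* The reference polynomial is [x^2 + 1]. *)
- by apply: (card_orbits_one_rootless (@rootless_rcf R)) => s n rl;
  exact: rootless_unique_rcf.
- by move=> F; apply: card_orbits_no_rootless; exact: (@rootless_closed F).
Qed.
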